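(* Let $T\in(0,\infty)$, let $\mathcal U\colon[0,T]\times C([-T,0])\to\mathbb R$ be of class $C^{1,2}(([0,T]\times\mathrm{past})\times\mathrm{present})$ and let $X=(X_t)_{t\in[0,T]}$ be a real continuous finite quadratic variation process on a probability space $(\Omega,\mathcal F,\mathbb P)$, with window process $\mathbb X$. Then the following functional Itô formula holds, $\mathbb P$-a.s., \[ \mathcal U(t,\mathbb X_t)=\mathcal U(0,\mathbb X_0)+\int_0^t\big(\partial_t\mathcal U(s,\mathbb X_s)+D^H\mathcal U(s,\mathbb X_s)\big)ds+\int_0^t D^V\mathcal U(s,\mathbb X_s)\,d^-X_s+\frac12\int_0^t D^{VV}\mathcal U(s,\mathbb X_s)\,d[X]_s \] for all $0\le t\le T$.
   Context: **Processes.** A real continuous process $X=(X_t)_{t\in[0,T]}$ is extended to $t\in\mathbb R$ by $X_t=X_0$ for $t\le 0$ and $X_t=X_T$ for $t\ge T$. Its window process is the $C([-T,0])$-valued process $\mathbb X_t=\{X_{t+x},\,x\in[-T,0]\}$, $t\in\mathbb R$. For a $\mathbb P$-a.s. integrable process $Y=(Y_t)_{t\in[0,T]}$, the forward integral $\int_0^\cdot Y\,d^-X$ is a continuous process which is a modification of the random function $t\mapsto\lim_{\varepsilon\to0^+}\int_0^tY_s\frac{X_{s+\varepsilon}-X_s}{\varepsilon}ds$, provided that this limit exists in probability for every $t\in[0,T]$ and such a continuous modification exists. (Asserting a formula that contains a forward integral includes asserting its existence.) $X$ is a finite quadratic variation process if $[X]_t=\lim_{\varepsilon\to0^+}\frac1\varepsilon\int_0^t(X_{s+\varepsilon}-X_s)^2ds$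 exists in probability for every $t\in[0,T]$ and the limiting random function admits a continuous version, denoted $[X]$. **Spaces.** $C([-T,0])$ is the Banach space of real continuous functions on $[-T,0]$ with the supremum norm $\|\cdot\|_\infty$. $\mathscr C([-T,0])$ is the set of bounded functions $\eta\colon[-T,0]\to\mathbb R$ that are continuous on $[-T,0)$. For $M>0$, $\mathscr C_M([-T,0])$ is the subset of functions bounded by $M$, with the topology induced by the seminorms $p_K(\eta)=\sup_{x\in K}|\eta(x)|+|\eta(0)|$, $K\subset[-T,0)$ compact. $\mathscr C([-T,0])$ carries the inductive topology, i.e. the finest topology making all inclusions $\mathscr C_M([-T,0])\to\mathscr C([-T,0])$ continuous. $C([-T,0])$ is dense in $\mathscr C([-T,0])$. $\mathscr C([-T,0))$ is the set of bounded continuous functions $\gamma\colon[-T,0)\to\mathbb R$. For $u\colon[0,T]\times\mathscr C([-T,0])\to\mathbb R$ one sets $\tilde u(t,\gamma,a)=u(t,\gamma1_{[-T,0)}+a1_{\{0\}})$ for $(t,\gamma,a)\in[0,T]\times\mathscr C([-T,0))\times\mathbb R$. **Functional derivatives.** For $\gamma\in\mathscr C([-T,0))$ and $\varepsilon\ge0$, $\gamma(\cdot-\varepsilon)$ denotes the shifted path $x\mapsto\gamma(x-\varepsilon)$ on $[-T,0)$, with the convention $\gamma(y)=\gamma(-T)$ for $y<-T$. The horizontal derivative is \[ D^H\tilde u(t,\gamma,a)=\lim_{\varepsilon\to0^+}\frac{\tilde u(t,\gamma(\cdot),a)-\tilde u(t,\gamma(\cdot-\varepsilon),a)}{\varepsilon}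 \] when this limit exists and is finite, and $D^Hu(t,\eta)=D^H\tilde u(t,\eta_{|[-T,0)},\eta(0))$. The vertical derivatives are $D^Vu(t,\eta)=\partial_a\tilde u(t,\eta_{|[-T,0)},\eta(0))$ and $D^{VV}u(t,\eta)=\partial^2_{aa}\tilde u(t,\eta_{|[-T,0)},\eta(0))$. $u\colon[0,T]\times\mathscr C([-T,0])\to\mathbb R$ is of class $\mathscr C^{1,2}(([0,T]\times\mathrm{past})\times\mathrm{present})$ if: (i) $u$ is continuous; (ii) $\partial_tu$ exists everywhere on $[0,T]\times\mathscr C([-T,0])$ and is continuous; (iii) $D^Hu$ exists everywhere on $[0,T]\times\mathscr C([-T,0])$ and for every $\gamma\in\mathscr C([-T,0))$ the map $(t,\varepsilon,a)\mapsto D^H\tilde u(t,\gamma(\cdot-\varepsilon),a)$ is continuous on $[0,T]\times[0,\infty)\times\mathbb R$; (iv) $D^Vu$ and $D^{VV}u$ exist everywhere on $[0,T]\times\mathscr C([-T,0])$ and are continuous. $\mathcal U\colon[0,T]\times C([-T,0])\to\mathbb R$ is of class $C^{1,2}(([0,T]\times\mathrm{past})\times\mathrm{present})$ if it admits a (necessarily unique) extension $u\colon[0,T]\times\mathscr C([-T,0])\to\mathbb R$ of class $\mathscr C^{1,2}(([0,T]\times\mathrm{past})\times\mathrm{present})$; then $D^H\mathcal U$, $D^V\mathcal U$, $D^{VV}\mathcal U$ are defined at $(t,\eta)\in[0,T]\times C([-T,0])$ as the values of $D^Hu$, $D^Vu$, $D^{VV}u$ at $(t,\eta)$. *)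

(* Defs.v *)
From HB Require Import structures.
From mathcomp Require Import all_boot all_order all_algebra.
From mathcomp Require Import all_classical all_reals all_analysis.
Set Implicit Arguments.
Unset Strict Implicit.
Unset Printing Implicit Defensive.
Import Order.TTheory GRing.Theory Num.Theory.
Import numFieldNormedType.Exports.
Local Open Scope classical_set_scope.
Local Open Scope ring_scope.

Section PathSpaces.
Context {R : realType}.
Implicit Type T : {posnum R}.

Definition time_itv T : set R := `[0, T%:num].
Definition window_itv T : set R := `[- T%:num, 0].
Definition past_itv T : set R := `[- T%:num, 0[.

(* In the three types below a function on A = [-T,0] or A = [-T,0) is
   represented by its extension by 0 to R, so that equality of paths is
   pointwise equality on A. *)

(* $\mathscr C([-T,0])$ *)
Record bpath T := BPath {
  bpath_val :> R -> R ;
  bpath_out : forall x, ~ window_itv T x -> bpath_val x = 0 ;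
  bpath_bounded : [bounded bpath_val x | x in window_itv T] ;
  bpath_cont : {within past_itv T, continuous bpath_val} }.

(* $\mathscr C([-T,0))$ *)
Record ppath T := PPath {
  ppath_val :> R -> R ;
  ppath_out : forall x, ~ past_itv T x -> ppath_val x = 0 ;
  ppath_bounded : [bounded ppath_val x | x in past_itv T] ;
  ppath_cont : {within past_itv T, continuous ppath_val} }.

(* $C([-T,0])$ *)
Record cpath T := CPath {
  cpath_val :> R -> R ;
  cpath_out : forall x, ~ window_itv T x -> cpath_val x = 0 ;
  cpath_cont : {within window_itv T, continuous cpath_val} }.

Lemma past_window T : past_itv T `<=` window_itv T.
Proof. by apply: subset_itvl; rewrite bnd_simp. Qed.

Lemma window0 T : window_itv T 0.
Proof. by rewrite /window_itv /= in_itv /= oppr_le0 ge0 lexx. Qed.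

Lemma within_continuous_sub_comp (A B : set R) (f g : R -> R) :
  continuous g -> (forall x, A x -> B (g x)) ->
  {within B, continuous f} -> {within A, continuous (f \o g)}.
Proof.
move=> cg AB /subspace_continuousP cf; apply/subspace_continuousP => x Ax W.
move=> /(cf _ (AB _ Ax)) /(cg x) gW.
by apply: (@filterS _ (nbhs x)) gW => y /= yW /AB; exact: yW.
Qed.

(* The distance p_K(eta - zeta); sup set0 is 0. *)
Definition pK_dist T (K : set R) (eta zeta : bpath T) : R :=
  sup [set `|eta x - zeta x| | x in K] + `|eta 0 - zeta 0|.

(* $\mathscr C_M([-T,0])$ *)
Definition bounded_by T (M : R) : set (bpath T) :=
  [set eta | forall x, window_itv T x -> `|eta x| <= M].

(* The trace of V on $\mathscr C_M([-T,0])$ is open. The seminorms are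
   directed (p_K and p_L are at most p_(K `|` L)), so one of them is enough
   for a basic neighbourhood. *)
Definition open_in_bounded T (M : R) (V : set (bpath T)) :=
  forall eta, bounded_by M eta -> V eta ->
  exists K e, [/\ compact K, K `<=` past_itv T, 0 < e &
    forall zeta, bounded_by M zeta -> pK_dist K zeta eta < e -> V zeta].

(* The finest topology for which every inclusion of $\mathscr C_M([-T,0])$ is
   continuous. *)
Definition bpath_open T : set_system (bpath T) :=
  [set V | forall M, 0 < M -> open_in_bounded M V].

Lemma bpath_ub T (eta : bpath T) :
  exists M, forall x, window_itv T x -> `|eta x| <= M.
Proof.
have [M [_ h]] := bpath_bounded eta; exists (M + 1) => x Tx.
by apply: (h (M + 1)) => //; rewrite ltrDl.
Qed.

Lemma pK_distS T (K L : set R) (eta zeta : bpath T) :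
  K `<=` L -> L `<=` past_itv T -> pK_dist K eta zeta <= pK_dist L eta zeta.
Proof.
move=> KL LT; rewrite lerD2r.
have [M1 h1] := bpath_ub eta; have [M2 h2] := bpath_ub zeta.
have hL : has_ubound [set `|eta x - zeta x| | x in L].
  exists (M1 + M2) => _ [x Lx <-]; have Wx := past_window (LT _ Lx).
  by rewrite (le_trans (ler_normB _ _))// lerD ?h1 ?h2.
have [[y Ky]|/nonemptyPn->] := pselect (K !=set0).
  apply: ge_sup; first by exists `|eta y - zeta y|; exists y.
  by move=> _ [x Kx <-]; apply: ub_le_sup => //; exists x => //; exact: KL.
rewrite image_set0 sup0.
have [[y Ly]|/nonemptyPn->] := pselect (L !=set0); last by rewrite image_set0 sup0.
by rewrite (@le_trans _ _ `|eta y - zeta y|)//; apply: ub_le_sup => //; exists y.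
Qed.

Lemma bpath_openT T : bpath_open [set: bpath T].
Proof. by move=> M _ eta _ _; exists set0, 1; split => //; exact: compact0. Qed.

Lemma bpath_openI T : setI_closed (@bpath_open T).
Proof.
move=> V W oV oW M M0 eta Me [Ve We].
have [K [e [cK KT e0 hK]]] := oV M M0 eta Me Ve.
have [L [f [cL LT f0 hL]]] := oW M M0 eta Me We.
have KLT : K `|` L `<=` past_itv T by rewrite subUset.
exists (K `|` L), (Num.min e f); split => //; first exact: compactU.
  by rewrite lt_min e0.
move=> zeta Mz; rewrite lt_min => /andP[ze zf]; split.
- by apply: hK => //; apply: le_lt_trans ze; apply: pK_distS => // x; left.
- by apply: hL => //; apply: le_lt_trans zf; apply: pK_distS => // x; right.
Qed.

Lemma bpath_open_bigU T (I : Type) (V : I -> set (bpath T)) :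
  (forall i, bpath_open (V i)) -> bpath_open (\bigcup_i V i).
Proof.
move=> oV M M0 eta Me [i _ Vie].
have [K [e [cK KT e0 hK]]] := oV i M M0 eta Me Vie.
by exists K, e; split => // zeta Mz /hK Viz; exists i => //; exact: Viz.
Qed.

HB.instance Definition _ T := gen_eqMixin (bpath T).
HB.instance Definition _ T := gen_choiceMixin (bpath T).
HB.instance Definition _ T := @isOpenTopological.Build (bpath T)
  (@bpath_open T) (@bpath_openT T) (@bpath_openI T) (@bpath_open_bigU T).

Lemma cpath_bounded T (eta : cpath T) : [bounded eta x | x in window_itv T].
Proof.
have : compact (eta @` window_itv T).
  apply: continuous_compact; first exact: cpath_cont.
  exact: segment_compact.
move=> /(@compact_bounded _ R^o)[M [Mr h]]; exists M; split => // y My x Tx.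
by apply: (h y My); exists x.
Qed.

Definition bpath_of_cpath T (eta : cpath T) : bpath T :=
  BPath (@cpath_out T eta) (cpath_bounded eta)
    (continuous_subspaceW (@past_window T) (cpath_cont (c := eta))).

Section Restriction.
Variables (T : {posnum R}) (eta : bpath T).

Let f := patch (fun=> 0) (past_itv T) eta.

Let f_out x : ~ past_itv T x -> f x = 0.
Proof. by move=> Tx; rewrite /f patchN// notin_setE. Qed.

Let f_bounded : [bounded f x | x in past_itv T].
Proof.
have [M [Mr h]] := bpath_bounded eta; exists M; split => // y My x Tx.
by rewrite /= /f patchT ?inE//; apply: (h y My); exact: past_window.
Qed.

Let f_cont : {within past_itv T, continuous f}.
Proof.
apply: (@subspace_eq_continuous _ _ _ eta); last exact: bpath_cont.
by move=> x Tx; rewrite /from_subspace /f patchT.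
Qed.

Definition past_of : ppath T := PPath f_out f_bounded f_cont.
End Restriction.

Section Gluing.
Variables (T : {posnum R}) (gamma : ppath T) (a : R).

Let f x := if x == 0 then a else gamma x.

Let f_past x : past_itv T x -> f x = gamma x.
Proof. by rewrite /past_itv /f /= in_itv /= => /andP[_ /lt_eqF->]. Qed.

Let f_out x : ~ window_itv T x -> f x = 0.
Proof.
move=> Tx; rewrite /f; case: eqP => [x0|_].
  by exfalso; apply: Tx; rewrite x0; exact: window0.
by apply: ppath_out => /past_window.
Qed.

Let f_bounded : [bounded f x | x in window_itv T].
Proof.
have [M [Mr h]] := ppath_bounded gamma.
exists (Num.max M `|a|); split; first exact: num_real.
move=> y; rewrite gt_max => /andP[My ay] x Tx; rewrite /= /f.
case: eqP => [_|/eqP x0]; first exact: ltW.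
apply: (h y My); move: Tx; rewrite /window_itv /past_itv /= !in_itv /=.
by move=> /andP[-> xle0]; rewrite lt_neqAle x0.
Qed.

Let f_cont : {within past_itv T, continuous f}.
Proof.
apply: (@subspace_eq_continuous _ _ _ gamma); last exact: ppath_cont.
by move=> x /[!inE] Tx; rewrite /from_subspace f_past.
Qed.

(* gamma 1_[-T,0) + a 1_{0} *)
Definition glue : bpath T := BPath f_out f_bounded f_cont.
End Gluing.

Section Shift.
Variables (T : {posnum R}) (e : R) (gamma : ppath T).

Let g (x : R) := Num.max (x - Num.max e 0) (- T%:num).

Let g_past x : past_itv T x -> past_itv T (g x).
Proof.
rewrite /past_itv /g /= !in_itv /= => /andP[_ x0].
rewrite le_max lexx orbT /= gt_max oppr_lt0 gt0 andbT.
by rewrite (le_lt_trans _ x0)// gerBl le_max lexx orbT.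
Qed.

Let f := patch (fun=> 0) (past_itv T) (gamma \o g).

Let f_out x : ~ past_itv T x -> f x = 0.
Proof. by move=> Tx; rewrite /f patchN// notin_setE. Qed.

Let f_bounded : [bounded f x | x in past_itv T].
Proof.
have [M [Mr h]] := ppath_bounded gamma; exists M; split => // y My x Tx.
by rewrite /= /f patchT ?inE//; apply: (h y My); exact: g_past.
Qed.

Let f_cont : {within past_itv T, continuous f}.
Proof.
have cg : continuous g.
  move=> x; apply: (@continuous_max _ _ (fun y => y - Num.max e 0) (fun=> _)).
    by apply: cvgB; [exact: cvg_id|exact: cvg_cst].
  exact: cvg_cst.
apply: (@subspace_eq_continuous _ _ _ (gamma \o g)).
  by move=> x Tx; rewrite /from_subspace /f patchT.
exact: within_continuous_sub_comp cg g_past (@ppath_cont T gamma).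
Qed.

(* gamma(. - e), which is relevant for 0 <= e only. *)
Definition shift_past : ppath T := PPath f_out f_bounded f_cont.
End Shift.

End PathSpaces.

Section FunctionalDerivatives.
Context {R : realType} {T : {posnum R}}.

(* Functions of time are total on R; only their values on [0,T] matter. *)

Definition quotient_t {E : Type} (u : R -> E -> R) (t : R) (eta : E) (s : R) :=
  (u s eta - u t eta) / (s - t).

(* The time derivative is relative to [0,T], hence one-sided at 0 and T. *)
Definition Dt_exists {E : Type} (u : R -> E -> R) t eta :=
  cvg (quotient_t u t eta @ within (time_itv T) t^').
Definition Dt {E : Type} (u : R -> E -> R) t eta : R :=
  lim (quotient_t u t eta @ within (time_itv T) t^').

Definition tilde (u : R -> bpath T -> R) (t : R) (gamma : ppath T) (a : R) :=
  u t (glue gamma a).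

Definition quotient_H (v : R -> ppath T -> R -> R) t gamma a (e : R) :=
  (v t gamma a - v t (shift_past e gamma) a) / e.

Definition DH_tilde_exists (v : R -> ppath T -> R -> R) t gamma a :=
  cvg (quotient_H v t gamma a @ 0^'+).
Definition DH_tilde (v : R -> ppath T -> R -> R) t gamma a : R :=
  lim (quotient_H v t gamma a @ 0^'+).

Definition DH_exists u t (eta : bpath T) :=
  DH_tilde_exists (tilde u) t (past_of eta) (eta 0).
Definition DH u t (eta : bpath T) : R :=
  DH_tilde (tilde u) t (past_of eta) (eta 0).

Definition DV_exists u t (eta : bpath T) :=
  derivable (tilde u t (past_of eta)) (eta 0) 1.
Definition DV u t (eta : bpath T) : R :=
  derive1 (tilde u t (past_of eta)) (eta 0).

Definition DVV_exists u t (eta : bpath T) :=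
  derivable (derive1 (tilde u t (past_of eta))) (eta 0) 1.
Definition DVV u t (eta : bpath T) : R :=
  derive1n 2 (tilde u t (past_of eta)) (eta 0).

Definition continuous_on_domain (f : R -> bpath T -> R) :=
  {within [set z : R * bpath T | time_itv T z.1],
    continuous (fun z : R * bpath T => f z.1 z.2)}.

(* $\mathscr C^{1,2}(([0,T]\times past)\times present)$ *)
Definition bpath_C12 (u : R -> bpath T -> R) : Prop :=
  [/\ continuous_on_domain u,
      (forall t eta, time_itv T t -> Dt_exists u t eta) /\
        continuous_on_domain (Dt u),
      (forall t eta, time_itv T t -> DH_exists u t eta) /\
        (forall gamma : ppath T,
          {within [set z : R * R * R | time_itv T z.1.1 /\ 0 <= z.1.2],
            continuous (fun z : R * R * R =>
              DH_tilde (tilde u) z.1.1 (shift_past z.1.2 gamma) z.2)}) &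
      [/\ forall t eta, time_itv T t -> DV_exists u t eta /\ DVV_exists u t eta,
          continuous_on_domain (DV u) & continuous_on_domain (DVV u)]].

Definition extends (u : R -> bpath T -> R) (U : R -> cpath T -> R) :=
  forall t eta, time_itv T t -> u t (bpath_of_cpath eta) = U t eta.

(* $C^{1,2}(([0,T]\times past)\times present)$ *)
Definition cpath_C12 (U : R -> cpath T -> R) : Prop :=
  exists u, bpath_C12 u /\ extends u U.

(* The choice is immaterial: on [0,T] the extension is unique, by density of
   $C([-T,0])$. *)
Definition extension (U : R -> cpath T -> R) : R -> bpath T -> R :=
  xget (fun _ _ => 0) [set u | bpath_C12 u /\ extends u U].

Definition cDH U t (eta : cpath T) := DH (extension U) t (bpath_of_cpath eta).
Definition cDV U t (eta : cpath T) := DV (extension U) t (bpath_of_cpath eta).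
Definition cDVV U t (eta : cpath T) := DVV (extension U) t (bpath_of_cpath eta).

End FunctionalDerivatives.
Arguments Dt_exists {R} T {E} u t eta.
Arguments Dt {R} T {E} u t eta.

Section Processes.
Context {R : realType} (T : {posnum R}).
Context d (Omega : measurableType d) (P : probability Omega R).

(* Only the values for t in [0,T] matter. *)
Record cprocess := CProcess {
  cprocess_val :> R -> Omega -> R ;
  cprocess_meas : forall t, time_itv T t -> measurable_fun setT (cprocess_val t) ;
  cprocess_cont : forall w, {within time_itv T, continuous (cprocess_val ^~ w)} }.

(* X_t for every real t, constant on either side of [0,T]. *)
Definition stopped (X : cprocess) (t : R) (w : Omega) : R :=
  X (Num.min T%:num (Num.max 0 t)) w.

Lemma stopped_continuous X w : continuous (stopped X ^~ w).
Proof.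
apply/continuous_subspace_setT.
apply: (@within_continuous_sub_comp _ setT (time_itv T) (X ^~ w)
  (fun t => Num.min T%:num (Num.max 0 t))).
- move=> x.
  have := @continuous_min R R (fun=> T%:num) (fun y => Num.max 0 y) x; apply.
    exact: cvg_cst.
  by have := @continuous_max R R (fun=> 0) id x; apply; [exact: cvg_cst|exact: cvg_id].
- move=> x _; rewrite /time_itv /= in_itv /= ge_min lexx /= andbT.
  by rewrite le_min ge0 le_max lexx.
- exact: cprocess_cont.
Qed.

Section Window.
Variables (X : cprocess) (t : R) (w : Omega).

Let f := patch (fun=> 0) (window_itv T) (fun x => stopped X (t + x) w).

Let f_out x : ~ window_itv T x -> f x = 0.
Proof. by move=> Tx; rewrite /f patchN// notin_setE. Qed.

Let f_cont : {within window_itv T, continuous f}.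
Proof.
apply: (@subspace_eq_continuous _ _ _ (fun x => stopped X (t + x) w)).
  by move=> x Tx; rewrite /from_subspace /f patchT.
apply: continuous_subspaceT => x.
apply: (@continuous_comp _ _ _ (fun y => t + y) (stopped X ^~ w)).
  by apply: cvgD; [exact: cvg_cst|exact: cvg_id].
exact: stopped_continuous.
Qed.

Definition window : cpath T := CPath f_out f_cont.
End Window.

(* Measurability is part of the definition because P is arbitrary on
   non-measurable sets. *)
Definition cvg_in_probability {I : Type} (F : set_system I)
    (Z : I -> Omega -> R) (L : Omega -> R) : Prop :=
  [/\ \forall i \near F, measurable_fun setT (Z i),
      measurable_fun setT L &
      forall r : R, 0 < r ->
        P [set w | r < `|Z i w - L w| ] @[i --> F] --> 0%E].

(* I is the forward integral of Y with respect to X, $\int_0^\cdot Y d^-X$. *)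
Definition is_forward_integral (Y : R -> Omega -> R) (X I : cprocess) : Prop :=
  [/\ forall t, time_itv T t -> measurable_fun setT (Y t),
      {ae P, forall w,
        (@lebesgue_measure R).-integrable (time_itv T) (EFin \o (Y ^~ w))} &
      forall t, time_itv T t ->
        cvg_in_probability 0^'+
          (fun e w => \int[@lebesgue_measure R]_(s in `[0, t])
             (Y s w * ((stopped X (s + e) w - stopped X s w) / e)))
          (I t)].

(* Q is (a continuous version of) the bracket [X]; X is a finite quadratic
   variation process when such a Q exists. *)
Definition is_quadratic_variation (X Q : cprocess) : Prop :=
  forall t, time_itv T t ->
    cvg_in_probability 0^'+
      (fun e w => e^-1 * \int[@lebesgue_measure R]_(s in `[0, t])
         (stopped X (s + e) w - stopped X s w) ^+ 2)
      (Q t).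

End Processes.

(* Main.v *)
Require Import Defs.
From HB Require Import structures.
From mathcomp Require Import all_boot all_order all_algebra.
From mathcomp Require Import all_classical all_reals all_analysis.
From mathcomp Require Import measurable_realfun.
From mathcomp Require Import lra ring.
Set Implicit Arguments.
Unset Strict Implicit.
Unset Printing Implicit Defensive.
Import Order.TTheory GRing.Theory Num.Theory.
Import numFieldNormedType.Exports.
Local Open Scope classical_set_scope.
Local Open Scope ring_scope.

(* Fix a path x with window process W, and let u be the extension of U. The
   increment u(s', W_s') - u(s, W_s) is split at (s', W_s|[-T,0), x_s') and
   (s, W_s|[-T,0), x_s'). The past of W_s is the past of W_s' shifted by s' - s,
   and both are shifts of the past of W_T, so the first piece is an increment
   of a function whose right derivative is a horizontal derivative, continuous
   in the shift by condition (iii); the second is a time increment and the third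
   a second-order Taylor expansion. By uniform continuity on compact sets,
     u(s', W_s') - u(s, W_s) = (Dt u + DH u)(s' - s) + DV u (x_s' - x_s)
       + DVV u (x_s' - x_s)^2 / 2 + o(s' - s) + o((x_s' - x_s)^2)
   uniformly in s. Taking s' = s + e, dividing by e and integrating over [0,t],
   the left-hand side tends to u(t, W_t) - u(0, W_0) and the measures
   (x_{s+e} - x_s)^2 ds / e converge weakly to d[X] along any e_n -> 0 for which
   their distribution functions converge on a dense set; hence the integrals
   defining the forward integral converge too. Convergence in probability
   follows by choosing the e_n small enough for Borel-Cantelli. *)

(** * Uniform continuity and Riemann-Stieltjes sums *)

(** The forward integral has to be shown to exist. Its candidate [ito_val] is the formula solved for
    it path by path, so the formula itself becomes an identity of real numbers; the work lies in
    proving that the candidate is a measurable continuous process and the limit in probability. Two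
    features of the horizontal derivative shape the expansion. It is continuous only along the
    shifts of one fixed past, which is why every past is written as a shift of the past of W_T. It
    is also one-sided, which calls for a mean value inequality with right derivatives. The limit of
    the squared increments is read off Riemann-Stieltjes sums: one partition approximates the
    integrals against all nonnegative densities of bounded mass at once, so the bracket matters only
    at countably many times and a single null set suffices. *)

Section UniformContinuity.
Context {R : realType}.

(** The near-covering form of compactness merges the moduli of continuity around the points of [K]
    into one radius. *)
Lemma compact_uniform_continuous (V : pseudoMetricType R) (K : set V) (f : V -> R) :
  compact K -> {within K, continuous f} ->
  forall e : R, 0 < e -> exists2 r : R, 0 < r &
    forall x y, K x -> K y -> ball x r y -> `|f x - f y| <= e.
Proof.
move=> /compact_near_coveringP/near_covering_withinP cK /subspace_continuousP cf e e0.
have h : forall x, K x ->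
    \forall x' \near x & r \near (0:R)^'+, K x' ->
      (forall y, K y -> ball x' r y -> `|f x' - f y| <= e).
  move=> x Kx.
  have e20 : 0 < e / 2 by rewrite divr_gt0.
  move: (cf x Kx) => /cvgrPdist_lt /(_ _ e20); rewrite near_withinE.
  move=> /nbhs_ballP[r /= r0 hr].
  have r20 : 0 < r / 2 by rewrite divr_gt0.
  exists (ball x (r / 2), [set q | q < r / 2]) => /=.
    split; first by apply: nbhsx_ballx.
    exact: nbhs_right_lt.
  move=> [x' q] /= [xx' qr] Kx' y Ky x'y.
  have xy : ball x r y.
    apply: (@ball_split _ _ x'); first exact: xx'.
    by apply: le_ball x'y; exact: ltW.
  have x'r : ball x r x' by apply: le_ball xx'; rewrite ler_pdivrMr// ler_peMr// ?ler1n// ltW.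
  have h1 := hr _ xy Ky; have h2 := hr _ x'r Kx'.
  rewrite (_ : f x' - f y = (f x - f y) - (f x - f x')); last by lra.
  rewrite (le_trans (ler_normB _ _))// (splitr e) lerD// ltW//.
have H := cK R 0^'+ (fun r x => forall y, K y -> ball x r y -> `|f x - f y| <= e)
  (at_right_proper_filter 0) h.
have [r [r0 hr]] := filter_ex (filterI (nbhs_right_gt (0 : R)) H).
by exists r => // x y Kx Ky; apply: hr.
Qed.

End UniformContinuity.

Section RiemannStieltjesSums.
Context {R : realType}.
Implicit Types (f h G : R -> R) (t : R).

Lemma step_sum_bound (mu : {measure set (measurableTypeR R) -> \bar R}) f h
    (p c : nat -> R) (m : nat) (e : R) :
  (forall k, p k <= p k.+1) ->
  mu.-integrable `]p 0%N, p m] (EFin \o (fun x => f x * h x)) ->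
  mu.-integrable `]p 0%N, p m] (EFin \o h) ->
  (forall x, `]p 0%N, p m]%classic x -> 0 <= h x) ->
  (forall k x, (k < m)%N -> `]p k, p k.+1]%classic x -> `|f x - c k| <= e) ->
  `|\sum_(k < m) c k * \int[mu]_(x in `]p k, p k.+1]) h x -
    \int[mu]_(x in `]p 0%N, p m]) (f x * h x)| <=
  e * \int[mu]_(x in `]p 0%N, p m]) h x.
Proof.
move=> pS.
have p0 k : p 0%N <= p k by elim: k => // k /le_trans; exact.
elim: m => [|m IH] ifh ih h0 fc.
  by rewrite big_ord0 set_itv_ge ?bnd_simp ?lexx// ?Rintegral_set0 sub0r normrN normr0 mulr0.
have UE : `]p 0%N, p m.+1]%classic = `]p 0%N, p m] `|` `]p m, p m.+1].
  by rewrite -itv_bndbnd_setU// bnd_simp.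
have s1 : `]p 0%N, p m] `<=` `]p 0%N, p m.+1] by rewrite UE; left.
have s2 : `]p m, p m.+1] `<=` `]p 0%N, p m.+1] by rewrite UE; right.
have dsj : [disjoint `]p 0%N, p m] & `]p m, p m.+1]].
  apply/disj_setPS => x [] /=; rewrite !in_itv/= => /andP[_ a] /andP[b _].
  by move: (lt_le_trans b a); rewrite ltxx.
have m1 : measurable (`]p 0%N, p m] : set (measurableTypeR R)) by exact: measurable_itv.
have m2 : measurable (`]p m, p m.+1] : set (measurableTypeR R)) by exact: measurable_itv.
have m3 : measurable (`]p 0%N, p m.+1] : set (measurableTypeR R)) by exact: measurable_itv.
have ih1 := integrableS m3 m1 s1 ih.
have ih2 := integrableS m3 m2 s2 ih.
have ifh1 := integrableS m3 m1 s1 ifh.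
have ifh2 := integrableS m3 m2 s2 ifh.
have := IH ifh1 ih1 (fun x px => h0 x (s1 x px)) (fun k x km => fc k x (ltnW km)).
rewrite UE in ifh ih *.
rewrite !Rintegral_setU// big_ord_recr/= => IH'.
have step : `|c m * \int[mu]_(x in `]p m, p m.+1]) h x -
    \int[mu]_(x in `]p m, p m.+1]) (f x * h x)| <= e * \int[mu]_(x in `]p m, p m.+1]) h x.
  have ich : mu.-integrable `]p m, p m.+1] (EFin \o (fun x => c m * h x)).
    rewrite (_ : _ \o _ = (fun x => (c m)%:E * (h x)%:E)%E); first exact: integrableZl.
    by apply/funext => x /=; rewrite EFinM.
  have ieh : mu.-integrable `]p m, p m.+1] (EFin \o (fun x => e * h x)).
    rewrite (_ : _ \o _ = (fun x => e%:E * (h x)%:E)%E); first exact: integrableZl.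
    by apply/funext => x /=; rewrite EFinM.
  rewrite -!RintegralZl// -RintegralB//.
  apply: le_trans (le_normr_Rintegral _ _) _ => //.
    rewrite (_ : _ \o _ = (fun x => (c m * h x)%:E - (f x * h x)%:E)%E) //.
    exact: integrableB.
  apply: le_Rintegral => //.
    rewrite (_ : _ \o _ = (fun x => `|(c m * h x)%:E - (f x * h x)%:E|)%E) //.
    by apply: integrable_abse; exact: integrableB.
  move=> x xm; rewrite -mulrBl normrM (ger0_norm (h0 _ (s2 _ xm))) ler_wpM2r ?h0//;
    first exact: s2.
  by rewrite distrC fc.
rewrite mulrDr; apply: le_trans (lerD IH' step).
by rewrite (le_trans _ (ler_normD _ _))// le_eqVlt;
  apply/orP; left; apply/eqP; congr `|_|; lra.
Qed.

Definition rssum f G t (m : nat) : R :=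
  \sum_(k < m.+1) f (t * (k%:R / m.+1%:R)) *
    (G (t * (k.+1%:R / m.+1%:R)) - G (t * (k%:R / m.+1%:R))).

(** The threshold [N] is chosen before [mu], [h] and [G], because it depends only on the modulus of
    continuity of [f]. The same partition therefore serves the Lebesgue densities of the squared
    increments and the limiting Stieltjes measure, the latter with [h = 1]. *)
Lemma rssum_approx f t : 0 <= t -> {within `[0, t], continuous f} ->
  forall e : R, 0 < e -> exists N, forall m, (N <= m)%N ->
    forall (mu : {measure set (measurableTypeR R) -> \bar R}) h G,
      mu.-integrable `]0, t] (EFin \o (fun x => f x * h x)) ->
      mu.-integrable `]0, t] (EFin \o h) ->
      (forall x, `]0, t]%classic x -> 0 <= h x) ->
      (forall x y, 0 <= x -> x <= y -> y <= t ->
        \int[mu]_(z in `]x, y]) h z = G y - G x) ->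
  `|rssum f G t m - \int[mu]_(x in `]0, t]) (f x * h x)| <= e * (G t - G 0).
Proof.
move=> t0 cf e e0.
have [r r0 hr] := compact_uniform_continuous (@segment_compact _ 0 t) cf e0.
(* From this index on, the mesh [t / m.+1] is smaller than [r]. *)
exists (Num.trunc (t / r)) => m Nm mu h G ifh ih h0 GE.
pose p k := t * (k%:R / m.+1%:R).
have m0 : (0:R) < m.+1%:R by rewrite ltr0n.
have p0 : p 0%N = 0 by rewrite /p mul0r mulr0.
have pm : p m.+1 = t by rewrite /p divff ?mulr1// gt_eqF.
have pS k : p k <= p k.+1.
  by rewrite ler_wpM2l// ler_pM2r ?invr_gt0// ler_nat.
have pge0 k : 0 <= p k by rewrite mulr_ge0// divr_ge0.
have ple k : (k <= m.+1)%N -> p k <= t.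
  by move=> km; rewrite /p ler_piMr// ler_pdivrMr// mul1r ler_nat.
have dp k : p k.+1 - p k < r.
  rewrite -mulrBr -mulrBl -natrB// subSnn mul1r ltr_pdivrMr//.
  rewrite -ltr_pdivrMl// mulrC (lt_le_trans (truncnS_gt _))//.
  by rewrite ler_nat.
have := @step_sum_bound mu f h p (fun k => f (p k)) m.+1 e pS.
rewrite p0 pm => /(_ ifh ih h0) H.
have {H} := H _.
have -> : \sum_(k < m.+1) f (p k) * \int[mu]_(x in `]p k, p k.+1]) h x = rssum f G t m.
  by apply: eq_bigr => k _; rewrite GE// ple.
rewrite GE//; apply => k x km /=; rewrite in_itv/= => /andP[px xp].
apply: hr.
- by rewrite /= in_itv/= (le_trans (pge0 k) (ltW px)) (le_trans xp)// ple.
- by rewrite /= in_itv/= pge0 ple// ltnW.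
- by rewrite -ball_normE/= ger0_norm ?subr_ge0 ?(ltW px)// (le_lt_trans _ (dp k))// lerD2r.
Qed.

End RiemannStieltjesSums.

(** * Right derivatives and Taylor expansion *)

Section Calculus.
Context {R : realType}.
Implicit Types (f : R -> R) (a b c : R).

(** With right derivatives only, the mean value theorem is replaced by a supremum argument: the set
    [S] of points where the bound holds with a slightly larger slope contains its supremum by
    continuity, and the right derivative there extends [S] further unless the supremum is [b]. *)
Lemma right_derivative_bound f a b c (d : R) :
  a <= b -> {within `[a, b], continuous f} ->
  (forall r, a <= r -> r < b -> exists2 l, `|l - c| <= d &
     (f (r + e) - f r) / e @[e --> 0^'+] --> l) ->
  `|f b - f a - c * (b - a)| <= d * (b - a).
Proof.
move=> ab cf df; apply/ler_addgt0Pr => e e0.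
have [->|anb] := eqVneq a b; first by rewrite !subrr !mulr0 subr0 normr0 add0r ltW.
have altb : a < b by rewrite lt_neqAle anb.
set q := d + e / (b - a).
have ba0 : 0 < b - a by rewrite subr_gt0.
have eba : 0 < e / (b - a) by rewrite divr_gt0.
rewrite [leRHS](_ : _ = q * (b - a)); last first.
  by rewrite /q mulrDl divfK// gt_eqF.
pose g x := `|f x - f a - c * (x - a)| - q * (x - a).
suff : g b <= 0 by rewrite subr_le0.
pose S := [set x | a <= x <= b /\ g x <= 0].
have Sa : S a by split; [rewrite lexx ab|rewrite /g !subrr !mulr0 !subr0 normr0].
have ubS : ubound S b by move=> x [/andP[]].
have hS : has_sup S by split; [exists a|exists b].
set s := sup S.
have as_ : a <= s by apply: ub_le_sup => //; exists b.
have sb : s <= b by apply: ge_sup => //; exists a.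
have cg : {within `[a, b], continuous g}.
  apply/subspace_continuousP => x xab.
  have cid_ : (fun z : R => z) @ within `[a, b]%classic (nbhs x) --> x.
    exact: cvg_within.
  move/subspace_continuousP : cf => /(_ x xab) cf.
  apply: cvgB; last by apply: cvgMr; apply: cvgB => //; exact: cvg_cst.
  apply: cvg_norm; apply: cvgB; first by apply: cvgB => //; exact: cvg_cst.
  by apply: cvgMr; apply: cvgB => //; exact: cvg_cst.
have gs : g s <= 0.
  rewrite leNgt; apply/negP => gs0.
  have sab : `[a, b]%classic s by rewrite /= in_itv/= as_ sb.
  move/subspace_continuousP : cg => /(_ s sab) /cvgrPdist_lt /(_ _ gs0).
  rewrite near_withinE => /nbhs_ballP[r /= r0 hr].
  have [x [/andP[ax xb] gx] sx] := sup_adherent r0 hS.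
  have xs : x <= s by apply: ub_le_sup; [exists b|split => //; rewrite ax].
  have := hr x; rewrite /from_subspace /= in_itv/= ax xb => /(_ _ isT).
  rewrite -ball_normE/= ger0_norm ?subr_ge0// ltrBlDr -ltrBlDl => /(_ sx).
  move/(le_lt_trans (ler_norm _)); lra.
have [sltb|] := ltP s b; last by move=> bs; have -> : b = s by apply/eqP; rewrite eq_le bs sb.
have [l lc dl] := df s as_ sltb.
have e2 : 0 < e / (b - a) by [].
move: (dl) => /cvgrPdist_le /(_ _ eba) H.
have bs0 : 0 < b - s by rewrite subr_gt0.
have [z [[z0 zb] hz]] :=
  filter_ex (filterI (filterI (nbhs_right_gt (0:R)) (nbhs_right_le bs0)) H).
suff /(ub_le_sup (ex_intro _ b ubS)) : S (s + z) by rewrite -/s gerDl leNgt z0.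
split; first by rewrite (le_trans as_ (ltW _)) ?ltrDl//= addrC -lerBrDr.
move: gs; rewrite /g !subr_le0 => gs.
have fz : `|f (s + z) - f s - c * z| <= q * z.
  have -> : f (s + z) - f s - c * z = ((l - c) - (l - (f (s + z) - f s) / z)) * z.
    by field; rewrite gt_eqF.
  rewrite normrM (gtr0_norm z0) ler_pM2r//.
  by rewrite (le_trans (ler_normB _ _))// lerD.
have -> : f (s + z) - f a - c * (s + z - a) =
  (f s - f a - c * (s - a)) + (f (s + z) - f s - c * z) by ring.
by rewrite (le_trans (ler_normD _ _))// (le_trans (lerD gs fz))//
  -mulrDr (_ : s - a + z = s + z - a)//; ring.
Qed.

(** Distances to [a] replace an ordering of the endpoints, since path increments have either
    sign. *)
Lemma mean_value f (df : R -> R) a b :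
  (forall x : R, is_derive x 1 f (df x)) ->
  exists2 c, `|c - a| <= `|b - a| & f b - f a = df c * (b - a).
Proof.
move=> dfx.
have cf x y : {within `[x, y], continuous f}.
  apply: derivable_within_continuous => z _.
  exact: (@ex_derive _ _ _ _ _ _ _ (dfx z)).
have [ab|ba] := leP a b.
  have [c cab ->] := @MVT_segment R f df a b ab (fun x _ => dfx x) (cf _ _).
  exists c => //; move: cab; rewrite in_itv/= => /andP[ac cb].
  by rewrite !ger0_norm ?subr_ge0// lerD2r.
have [c cab E] := @MVT_segment R f df b a (ltW ba) (fun x _ => dfx x) (cf _ _).
exists c; last by rewrite -[LHS]opprB E -mulrN opprB.
move: cab; rewrite in_itv/= => /andP[ac cb].
by rewrite !ler0_norm ?subr_le0 ?(ltW ba)// lerN2 lerD2r.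
Qed.

(** The mean value theorem is applied to [f] minus its quadratic Taylor polynomial, then to the
    first derivative of [f]. This loses a factor 1/2 in the remainder, which is harmless here. *)
Lemma taylor2_bound f a b (d : R) :
  (forall x, derivable f x 1) -> (forall x, derivable (derive1 f) x 1) ->
  (forall x, `|x - a| <= `|b - a| ->
    `|derive1 (derive1 f) x - derive1 (derive1 f) a| <= d) ->
  `|f b - f a - (derive1 f) a * (b - a) - 2^-1 * derive1 (derive1 f) a * (b - a) ^+ 2| <=
    d * (b - a) ^+ 2.
Proof.
move=> df ddf H.
have Df (x : R) : is_derive x 1 f ((derive1 f) x).
  by rewrite derive1E; apply: DeriveDef.
have DDf (x : R) : is_derive x 1 (derive1 f) (derive1 (derive1 f) x).
  by rewrite [X in is_derive _ _ _ X]derive1E; apply: DeriveDef.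
set A1 := (derive1 f) a; set A2 := derive1 (derive1 f) a.
pose k x := f x - A1 * x - 2^-1 * A2 * (x - a) ^+ 2.
have Dk (x : R) : is_derive x 1 k ((derive1 f) x - A1 - A2 * (x - a)).
  rewrite /k.
  apply: is_derive_eq.
  by rewrite /GRing.scale/=; lra.
have [c ca E] := mean_value a b Dk.
have [c' ca' E'] := mean_value a c DDf.
have -> : f b - f a - A1 * (b - a) - 2^-1 * A2 * (b - a) ^+ 2 = k b - k a.
  by rewrite /k subrr expr0n/=; ring.
rewrite E (_ : _ - _ - _ = (derive1 (derive1 f) c' - A2) * (c - a)); last first.
  have factor (p q s t z : R) : q - s = p * z -> q - s - t * z = (p - t) * z.
    by move=> ->; rewrite mulrBl.
  exact: factor E'.
rewrite !normrM -(@real_normK _ (b - a)) ?num_real// expr2 mulrA.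
rewrite ler_wpM2r// ler_pM// H//; exact: le_trans ca' ca.
Qed.

End Calculus.

(** * Window paths *)

(* MathComp-Analysis has another [glue]. *)
Local Notation glue := Defs.glue.

Section Paths.
Context {R : realType} {T : {posnum R}}.

Lemma time_itvE (t : R) : time_itv T t = (0 <= t <= T%:num).
Proof. by rewrite /time_itv /= in_itv/=. Qed.

Lemma window_itvE (x : R) : window_itv T x = (- T%:num <= x <= 0).
Proof. by rewrite /window_itv /= in_itv/=. Qed.

Lemma past_itvE (x : R) : past_itv T x = (- T%:num <= x < 0).
Proof. by rewrite /past_itv /= in_itv/=. Qed.

Lemma bpath_ext (eta zeta : bpath T) :
  (forall x, window_itv T x -> eta x = zeta x) -> eta = zeta.
Proof.
move=> H; have : bpath_val eta = bpath_val zeta.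
  apply/funext => x; have [/H //|Tx] := pselect (window_itv T x).
  by rewrite !bpath_out.
case: eta zeta {H} => [f o b c] [g o' b' c'] /= fg; subst g.
by congr BPath; exact: Prop_irrelevance.
Qed.

Lemma ppath_ext (gamma delta : ppath T) :
  (forall x, past_itv T x -> gamma x = delta x) -> gamma = delta.
Proof.
move=> H; have : ppath_val gamma = ppath_val delta.
  apply/funext => x; have [/H //|Tx] := pselect (past_itv T x).
  by rewrite !ppath_out.
case: gamma delta {H} => [f o b c] [g o' b' c'] /= fg; subst g.
by congr PPath; exact: Prop_irrelevance.
Qed.

Lemma past_ofE (eta : bpath T) x : past_itv T x -> past_of eta x = eta x.
Proof. by move=> Tx; rewrite /= patchT// inE. Qed.

Lemma glue0 (gamma : ppath T) a : glue gamma a 0 = a.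
Proof. by rewrite /= eqxx. Qed.

Lemma glue_past (gamma : ppath T) a x : past_itv T x -> glue gamma a x = gamma x.
Proof. by rewrite past_itvE => /andP[_ x0] /=; rewrite lt_eqF. Qed.

Lemma past_of_glue (gamma : ppath T) a : past_of (glue gamma a) = gamma.
Proof. by apply: ppath_ext => x Tx; rewrite past_ofE// glue_past. Qed.

Lemma glue_past_of (eta : bpath T) : glue (past_of eta) (eta 0) = eta.
Proof.
apply: bpath_ext => x; rewrite window_itvE => /andP[Tx x0].
have [->|xn0] := eqVneq x 0; first by rewrite glue0.
have px : past_itv T x by rewrite past_itvE Tx lt_neqAle xn0.
by rewrite glue_past// past_ofE.
Qed.

Lemma shift_pastE e (gamma : ppath T) x : 0 <= e -> past_itv T x ->
  shift_past e gamma x = gamma (Num.max (x - e) (- T%:num)).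
Proof. by move=> e0 Tx; rewrite /= patchT ?inE//= (max_idPl e0). Qed.

(** The inductive topology is coarser than the uniform one. A radius at most 1 keeps [zeta] in the
    same set of paths bounded by [|M| + 1], and there [pK_dist] is at most twice the uniform
    distance, hence the [e / 4]. *)
Lemma bpath_sup_nbhs (eta : bpath T) (V : set (bpath T)) : nbhs eta V ->
  exists2 r : R, 0 < r & forall zeta : bpath T,
    (forall x, window_itv T x -> `|zeta x - eta x| <= r) -> V zeta.
Proof.
rewrite nbhsE => -[B [oB Beta] BV].
have [M hM] := bpath_ub eta.
have M0 : 0 < `|M| + 1 by rewrite ltr_wpDl.
have Meta : bounded_by (`|M| + 1) eta.
  by move=> x Tx; rewrite (le_trans (hM x Tx))// (le_trans (ler_norm M))// lerDl.
have [K [e [cK KT e0 hK]]] := oB _ M0 _ Meta Beta.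
have e40 : 0 < e / 4 by rewrite divr_gt0.
exists (Num.min 1 (e / 4)); first by rewrite lt_min ltr01.
move=> zeta H.
have h1 x : window_itv T x -> `|zeta x - eta x| <= 1.
  by move=> /H; rewrite le_min => /andP[].
have h2 x : window_itv T x -> `|zeta x - eta x| <= e / 4.
  by move=> /H; rewrite le_min => /andP[].
apply: BV; apply: hK => [x Tx|].
  rewrite -(subrK (eta x) (zeta x)) (le_trans (ler_normD _ _))// addrC lerD//.
    by rewrite (le_trans (hM x Tx))// ler_norm.
  exact: h1.
rewrite /pK_dist; apply: (@le_lt_trans _ _ (e / 4 + e / 4)); last by lra.
rewrite lerD//; last by apply: h2; exact: window0.
have [[y Ky]|/nonemptyPn->] := pselect (K !=set0); last by rewrite image_set0 sup0 ltW.
apply: ge_sup; first by eexists; exists y.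
by move=> _ [x /KT Tx <-]; apply: h2; exact: past_window.
Qed.

Lemma functional_continuous (f : R -> bpath T -> R) t : continuous_on_domain f ->
  time_itv T t -> continuous (f t).
Proof.
move=> /subspace_continuousP cf Tt eta V /(cf (t, eta) Tt).
move=> -[[A B] /= [nA nB] AB].
apply: filterS nB => zeta Bz; apply: (AB (t, zeta)) => //=; split => //=.
exact: nbhs_singleton.
Qed.

End Paths.

Section WindowPaths.
Context {R : realType} (T : {posnum R}).
Context d (Omega : measurableType d) (X : cprocess T Omega) (w : Omega).

Local Notation x_ s := (stopped X s w).
Local Notation win s := (bpath_of_cpath (window X s w)).
Local Notation pas s := (past_of (bpath_of_cpath (window X s w))).

Lemma stopped_id s : time_itv T s -> x_ s = X s w.
Proof.
by rewrite time_itvE /stopped => /andP[s0 sT]; rewrite (max_idPr s0) (min_idPr sT).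
Qed.

Lemma stopped_le0 s : s <= 0 -> x_ s = X 0 w.
Proof. by move=> s0; rewrite /stopped (max_idPl s0) min_r. Qed.

Lemma stopped_geT s : T%:num <= s -> x_ s = X T%:num w.
Proof.
by move=> sT; rewrite /stopped min_l// le_max sT orbT.
Qed.

Lemma win_val s x : window_itv T x -> win s x = x_ (s + x).
Proof. by move=> Tx; rewrite /= patchT// inE. Qed.

Lemma win0 s : win s 0 = x_ s.
Proof. by rewrite win_val ?addr0//; exact: window0. Qed.

Lemma glue_win s : glue (pas s) (x_ s) = win s.
Proof. by rewrite -win0 glue_past_of. Qed.

Lemma pas_val s x : past_itv T x -> pas s x = x_ (s + x).
Proof. by move=> Tx; rewrite past_ofE// win_val//; exact: past_window. Qed.

(** The convention that a past is constant to the left of -T agrees with the constant extension of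
    the process to negative times: as [s <= T], both sides equal the initial value wherever the
    convention applies. *)
Lemma shift_pas s r : 0 <= r -> s <= T%:num ->
  shift_past r (pas s) = pas (s - r).
Proof.
move=> r0 sT; apply: ppath_ext => x Tx.
have := Tx; rewrite past_itvE => /andP[Tx1 Tx2].
have px : past_itv T (Num.max (x - r) (- T%:num)).
  rewrite past_itvE le_max lexx orbT/= gt_max oppr_lt0 gt0 andbT.
  by rewrite (le_lt_trans _ Tx2)// gerBl.
rewrite shift_pastE// !pas_val//.
have [xr|xr] := leP (x - r) (- T%:num); last by rewrite addrA addrAC.
by rewrite !stopped_le0// ?subr_le0// -addrA (addrC _ x); lra.
Qed.

Lemma stopped_uniform (e : R) : 0 < e -> exists2 r : R, 0 < r &
  forall s s', `|s - s'| < r -> `|x_ s - x_ s'| <= e.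
Proof.
move=> e0; have := compact_uniform_continuous (@segment_compact _ (- 1) (T%:num + 1))
  (continuous_subspaceT (@stopped_continuous _ _ _ _ X w)) e0.
move=> [r r0 hr].
(* Points closer than 1 lie both in [-1, T + 1], or both on a side of [0, T] where the path is
   constant. *)
exists (Num.min r 1); first by rewrite lt_min r0 ltr01.
move=> s s'; rewrite lt_min => /andP[sr s1].
have T0 : 0 < T%:num by [].
have [/andP[s0 s'0]|h1] := boolP ((s <= 0) && (s' <= 0)).
  by rewrite !stopped_le0// subrr normr0 ltW.
have [/andP[s0 s'0]|h2] := boolP ((T%:num <= s) && (T%:num <= s')).
  by rewrite !stopped_geT// subrr normr0 ltW.
move: s1 h1 h2; rewrite ltr_norml !negb_and -!ltNge => /andP[a b] h1 h2.
by apply: hr => //=; rewrite in_itv/=; apply/andP; case/orP: h1; case/orP: h2; split; lra.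
Qed.

Lemma stopped_bounded : exists2 M : R, 0 < M & forall s, `|x_ s| <= M.
Proof.
have [M [Mr hM]] := @compact_bounded _ R^o _
  (continuous_compact (continuous_subspaceT (@stopped_continuous _ _ _ _ X w))
   (@segment_compact _ 0 T%:num)).
exists (Num.max M 0 + 1); first by rewrite ltr_wpDl// le_max lexx orbT.
move=> s; apply: hM; first by rewrite ltr_pwDr// le_max lexx.
have Ts : time_itv T (Num.min T%:num (Num.max 0 s)).
  by rewrite time_itvE ge_min lexx /= andbT le_min ge0 le_max lexx.
by exists (Num.min T%:num (Num.max 0 s)) => //; rewrite stopped_id.
Qed.

Lemma glue_pas_continuous : continuous (fun z : R * R => glue (pas z.1) z.2).
Proof.
move=> [s a] V /bpath_sup_nbhs[e e0 he].
have [r r0 hr] := stopped_uniform e0.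
apply/nbhs_ballP; exists (Num.min r e) => /=; first by rewrite lt_min r0.
move=> [s' a'] [/=]; rewrite /ball/= !lt_min => /andP[ss' _] /andP[_ aa'].
apply: he => x; rewrite window_itvE => /andP[Tx x0].
have [->|xn0] := eqVneq x 0; first by rewrite !glue0 distrC ltW.
have px : past_itv T x by rewrite past_itvE Tx lt_neqAle xn0.
rewrite !glue_past// !pas_val//.
by apply: hr; rewrite opprD addrACA subrr addr0 distrC.
Qed.

(** Time, past and present become three independent real variables. Boxes are compact there, so
    continuity is uniform, and the mixed points of the splitting, such as the past of W_s with
    present x_s', are covered. *)
Lemma functional_box_continuous (f : R -> bpath T -> R) : continuous_on_domain f ->
  {within [set z : R * R * R | time_itv T z.1.1],
    continuous (fun z : R * R * R => f z.1.1 (glue (pas z.1.2) z.2))}.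
Proof.
move=> /subspace_continuousP cf; apply/subspace_continuousP => -[[t s] a] /= Tt W.
move=> /(cf (t, glue (pas s) a) Tt); rewrite /within/=.
have c1 : z.1.1 @[z --> nbhs (t, s, a)] --> t.
  by apply: (@cvg_comp _ _ _ (@fst (R * R) R) fst _ (nbhs (t, s))); exact: cvg_fst.
have c2 : z.1.2 @[z --> nbhs (t, s, a)] --> s.
  apply: (@cvg_comp _ _ _ (@fst (R * R) R) snd _ (nbhs (t, s))); first exact: cvg_fst.
  exact: cvg_snd.
have c3 : z.2 @[z --> nbhs (t, s, a)] --> a by exact: cvg_snd.
have c4 : glue (pas z.1.2) z.2 @[z --> nbhs (t, s, a)] --> glue (pas s) a.
  exact: (@cvg_comp _ _ _ _ _ _ _ _ (cvg_pair c2 c3) (@glue_pas_continuous (s, a))).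
have := cvg_pair c1 c4.
move=> h /h H; apply: (@filterS _ (nbhs (t, s, a)) _ _ _ _ H) => -[[t1 s1] a1] H1 Tt1.
exact: H1.
Qed.

End WindowPaths.

(** * Expansion along a path *)

Lemma continuous_pair (V W Z : topologicalType) (f : V -> W) (g : V -> Z) :
  continuous f -> continuous g -> continuous (fun x => (f x, g x)).
Proof. by move=> cf cg x; exact: cvg_pair (cf x) (cg x). Qed.

Lemma within_continuous_comp (V W Z : topologicalType) (A : set V) (D : set W)
    (g : V -> W) (f : W -> Z) :
  continuous g -> (forall x, A x -> D (g x)) ->
  {within D, continuous f} -> {within A, continuous (f \o g)}.
Proof.
move=> cg AD /subspace_continuousP cf; apply/subspace_continuousP => x Ax B.
move=> /(cf _ (AD _ Ax)) /(cg x) gB.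
by apply: (@filterS _ (nbhs x)) gB => y /= yB /AD; exact: yB.
Qed.

Lemma box_uniform_continuous {R : realType} (D : set (R * R * R)) (G : R * R * R -> R)
    (a b c d p q : R) :
  (forall t s z, a <= t <= b -> c <= s <= d -> p <= z <= q -> D (t, s, z)) ->
  {within D, continuous G} ->
  forall e : R, 0 < e -> exists2 r : R, 0 < r &
    forall t t' s s' z z', a <= t <= b -> a <= t' <= b -> c <= s <= d -> c <= s' <= d ->
      p <= z <= q -> p <= z' <= q ->
      `|t - t'| < r -> `|s - s'| < r -> `|z - z'| < r ->
      `|G (t, s, z) - G (t', s', z')| <= e.
Proof.
move=> KD cG e e0.
pose K := (`[a, b]%classic `*` `[c, d]%classic) `*` `[p, q]%classic.
have cK : compact K.
  apply: compact_setX; last exact: segment_compact.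
  by apply: compact_setX; exact: segment_compact.
have sKD : K `<=` D.
  by move=> [[t s] z] [/= [/= + +] +]; rewrite !in_itv/=; exact: KD.
have [r r0 hr] := compact_uniform_continuous cK (continuous_subspaceW sKD cG) e0.
exists r => // t t' s s' z z' it it' is_ is' iz iz' tt ss zz.
by apply: hr; rewrite /K /= ?in_itv.
Qed.

(** Intermediate points of the Taylor expansion may leave [-M, M], but by at most the length 2M of
    an increment. *)
Lemma range_triple {R : realFieldType} (M x y z : R) :
  - M <= x <= M -> - M <= y <= M -> `|z - x| <= `|y - x| -> - (3 * M) <= z <= 3 * M.
Proof.
move=> /andP[? ?] /andP[? ?]; rewrite ler_norml => /andP[].
by case: (ler0P (y - x)) => ? ? ?; apply/andP; split; lra.
Qed.

Section Expansion.
Context {R : realType} (T : {posnum R}).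
Context d (Omega : measurableType d) (X : cprocess T Omega) (w : Omega).

Local Notation x_ s := (stopped X s w).
Local Notation win s := (bpath_of_cpath (window X s w)).
Local Notation pas s := (past_of (bpath_of_cpath (window X s w))).

Lemma functional_win_continuous (f : R -> bpath T -> R) : continuous_on_domain f ->
  {within time_itv T, continuous (fun s => f s (win s))}.
Proof.
move=> /(functional_box_continuous (X := X) (w := w)) cf.
rewrite (_ : (fun s => _) =
    (fun z : R * R * R => f z.1.1 (glue (pas z.1.2) z.2)) \o (fun s => (s, s, x_ s))); last first.
  by apply/funext => s /=; rewrite glue_win.
apply: within_continuous_comp cf => //.
by apply: continuous_pair; [apply: continuous_pair|]; move=> s;
  [exact: cvg_id|exact: cvg_id|exact: stopped_continuous].
Qed.

(** Condition (iii) gives continuity along the shifts of one past only. It applies because the past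
    at time [s] is the past at time T shifted by [T - s]. *)
Lemma DH_win_continuous (u : R -> bpath T -> R) : bpath_C12 u ->
  {within time_itv T, continuous (fun s => DH u s (win s))}.
Proof.
move=> [_ _ [_ /(_ (pas T%:num)) cH] _].
pose g s := DH_tilde (tilde u) s (shift_past (T%:num - s) (pas T%:num)) (x_ s).
apply: (@subspace_eq_continuous _ _ _ g).
  move=> s /[!inE]; rewrite time_itvE => /andP[s0 sT].
  by rewrite /from_subspace /g /DH win0 shift_pas ?subr_ge0// subKr.
apply: (within_continuous_comp (g := fun s => (s, T%:num - s, x_ s)) _ _ cH).
  apply: continuous_pair; last exact: stopped_continuous.
  apply: continuous_pair => s; first exact: cvg_id.
  by apply: cvgB; [exact: cvg_cst|exact: cvg_id].
by move=> s /= Ts; split => //; move: Ts; rewrite time_itvE subr_ge0 => /andP[].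
Qed.

Lemma vertical_expansion (u : R -> bpath T -> R) (s a b e : R) :
  bpath_C12 u -> time_itv T s ->
  (forall z, `|z - a| <= `|b - a| ->
     `|DVV u s (glue (pas s) z) - DVV u s (glue (pas s) a)| <= e) ->
  `|u s (glue (pas s) b) - u s (glue (pas s) a) - DV u s (glue (pas s) a) * (b - a)
    - 2^-1 * DVV u s (glue (pas s) a) * (b - a) ^+ 2| <= e * (b - a) ^+ 2.
Proof.
move=> [_ _ _ [dV _ _]] Ts H.
have E1 z : DV u s (glue (pas s) z) = derive1 (tilde u s (pas s)) z.
  by rewrite /DV past_of_glue glue0.
have E2 z : DVV u s (glue (pas s) z) = derive1 (derive1 (tilde u s (pas s))) z.
  by rewrite /DVV past_of_glue glue0 /derive1n.
rewrite E1 E2; apply: taylor2_bound.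
- by move=> z; have [+ _] := dV s (glue (pas s) z) Ts; rewrite /DV_exists past_of_glue glue0.
- by move=> z; have [_] := dV s (glue (pas s) z) Ts; rewrite /DVV_exists past_of_glue glue0.
- by move=> z /H; rewrite !E2.
Qed.

Lemma time_expansion (u : R -> bpath T -> R) (eta : bpath T) (s s' c e : R) :
  bpath_C12 u -> 0 <= s -> s <= s' -> s' <= T%:num ->
  {within `[s, s'], continuous (fun t => u t eta)} ->
  (forall t, s <= t -> t < s' -> `|Dt T u t eta - c| <= e) ->
  `|u s' eta - u s eta - c * (s' - s)| <= e * (s' - s).
Proof.
move=> [_ [dt _] _ _] s0 ss' s'T cu H.
apply: (@right_derivative_bound _ (fun t => u t eta)) => // t st ts'.
exists (Dt T u t eta); first exact: H.
have Tt : time_itv T t by rewrite time_itvE (le_trans s0 st) (le_trans (ltW ts') s'T).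
have : quotient_t u t eta @ within (time_itv T) t^' --> Dt T u t eta by exact: dt.
move=> /(_ _) ct.
(* As [t < s' <= T], small steps to the right of [t] stay in [0, T], so the derivative relative to
   [0, T] is also a right derivative. *)
have c0 : (fun h => t + h) @ 0^'+ --> within (time_itv T) t^'.
  move=> B /=; rewrite /within/= => -[r /= r0 hB].
  change (\forall h \near 0^'+, B (t + h)).
  near=> h; apply: hB => /=.
  - rewrite opprD addrA subrr add0r normrN gtr0_norm; near: h.
      exact: nbhs_right_lt.
    exact: nbhs_right_gt.
  - by rewrite addrC -subr_eq0 addrK gt_eqF//; near: h; exact: nbhs_right_gt.
  - rewrite time_itvE; apply/andP; split.
      rewrite addr_ge0// ?(le_trans s0 st)//; near: h; exact: nbhs_right_ge.
    rewrite (le_trans _ s'T)// -lerBrDl; near: h; apply: nbhs_right_le.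
    by rewrite subr_gt0.
have := cvg_comp _ _ c0 ct.
rewrite (_ : _ \o _ = (fun h => (u (t + h) eta - u t eta) / h))//.
by apply/funext => h; rewrite /quotient_t/= addrAC subrr add0r.
Unshelve. all: by end_near. Qed.

Lemma horizontal_expansion (u : R -> bpath T -> R) (t a s s' c e : R) :
  bpath_C12 u -> time_itv T t -> 0 <= s -> s <= s' -> s' <= T%:num ->
  (forall r, T%:num - s' <= r -> r < T%:num - s ->
     `|DH_tilde (tilde u) t (shift_past r (pas T%:num)) a - c| <= e) ->
  `|u t (glue (pas s') a) - u t (glue (pas s) a) - c * (s' - s)| <= e * (s' - s).
Proof.
move=> [cu _ [dH _] _] Tt s0 ss' s'T H.
(* In the shift variable [r = T - s], a step to the right shifts the past further; the right
   derivative of [phi] is therefore minus the horizontal derivative, hence the [- c] below. *)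
pose phi r := u t (glue (pas (T%:num - r)) a).
suff : `|phi (T%:num - s) - phi (T%:num - s') - - c * ((T%:num - s) - (T%:num - s'))|
    <= e * ((T%:num - s) - (T%:num - s')).
  rewrite /phi !subKr (_ : T%:num - s - (T%:num - s') = s' - s); last by ring.
  by rewrite -[X in _ -> X <= _]normrN; congr (is_true (`|_| <= _)); ring.
apply: right_derivative_bound; first by rewrite lerD2l lerN2.
  apply: (within_continuous_comp (D := [set z : R * R * R | time_itv T z.1.1])
    (g := fun r => (t, T%:num - r, a))
    (f := fun z : R * R * R => u z.1.1 (glue (pas z.1.2) z.2))) => //.
    apply: continuous_pair; last by move=> r; exact: cvg_cst.
    apply: continuous_pair => r; first exact: cvg_cst.
    by apply: cvgB; [exact: cvg_cst|exact: cvg_id].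
  exact: functional_box_continuous.
move=> r r1 r2.
exists (- DH_tilde (tilde u) t (shift_past r (pas T%:num)) a).
  by rewrite -opprD normrN H.
have r0 : 0 <= r by rewrite (le_trans _ r1)// subr_ge0.
have : quotient_H (tilde u) t (pas (T%:num - r)) a @ 0^'+ -->
    DH_tilde (tilde u) t (pas (T%:num - r)) a.
  by have := dH t (glue (pas (T%:num - r)) a) Tt; rewrite /DH_exists past_of_glue glue0.
rewrite shift_pas// => /cvgN; apply: cvg_trans; apply: near_eq_cvg.
near=> h; rewrite /quotient_H /tilde opprfctE shift_pas; last 2 first.
- by near: h; exact: nbhs_right_ge.
- by rewrite gerBl.
by rewrite /phi opprD addrA -mulNr opprB.
Unshelve. all: by end_near. Qed.

(** The present moves last, at time [s] and with the past of W_s, so that the Taylor expansion is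
    centred exactly at W_s. The past and time increments are linear in [s' - s] and tolerate base
    points near W_s, by uniform continuity; they take [e / 2] each. *)
Lemma path_expansion (u : R -> bpath T -> R) : bpath_C12 u ->
  forall e : R, 0 < e -> exists2 r : R, 0 < r &
  forall s s', 0 <= s -> s <= s' -> s' <= T%:num -> s' - s < r ->
  `|u s' (win s') - u s (win s) - (Dt T u s (win s) + DH u s (win s)) * (s' - s)
    - DV u s (win s) * (x_ s' - x_ s)
    - 2^-1 * DVV u s (win s) * (x_ s' - x_ s) ^+ 2| <=
  e * (s' - s) + e * (x_ s' - x_ s) ^+ 2.
Proof.
move=> C e e0; have [cu [dt cdt] [dH cdH] [dV cV cVV]] := C.
have [M M0 hM] := stopped_bounded X w.
have bM s : - M <= x_ s <= M by rewrite -ler_norml.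
have e20 : 0 < e / 2 by rewrite divr_gt0.
have domH t s z : 0 <= t <= T%:num -> 0 <= s <= T%:num -> - M <= z <= M ->
    [set z : R * R * R | time_itv T z.1.1 /\ 0 <= z.1.2] (t, s, z).
  by rewrite /= time_itvE => -> /andP[].
have [r1 r10 h1] := box_uniform_continuous domH (cdH (pas T%:num)) e20.
have dom m t s z : 0 <= t <= T%:num -> 0 <= s <= T%:num -> - m <= z <= m ->
    [set z : R * R * R | time_itv T z.1.1] (t, s, z) by rewrite /= time_itvE.
have [r2 r20 h2] := box_uniform_continuous (dom M)
  (functional_box_continuous (X := X) (w := w) cdt) e20.
have [r3 r30 h3] := box_uniform_continuous (dom (3 * M))
  (functional_box_continuous (X := X) (w := w) cVV) e0.
pose r := Num.min r1 (Num.min r2 r3).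
have r0 : 0 < r by rewrite !lt_min r10 r20.
have r20' : 0 < r / 2 by rewrite divr_gt0.
have [q q0 hq] := stopped_uniform X w r20'.
exists (Num.min q r); first by rewrite lt_min q0.
move=> s s' s0 ss' s'T; rewrite lt_min => /andP[sq sr].
have : r <= r1 /\ r <= r2 /\ r <= r3 by rewrite /r !ge_min !lexx !orbT.
move=> [rr1 [rr2 rr3]].
have s'0 : 0 <= s' by exact: le_trans ss'.
have sT : s <= T%:num by exact: le_trans s'T.
have is_ : 0 <= s <= T%:num by rewrite s0.
have is' : 0 <= s' <= T%:num by rewrite s'0.
have xx : `|x_ s' - x_ s| <= r / 2 by apply: hq; rewrite ger0_norm ?subr_ge0.
have rr : r / 2 < r by move: r0; lra.
have nss : `|s - s'| < r by rewrite distrC ger0_norm ?subr_ge0.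
have nxx : `|x_ s - x_ s'| < r by rewrite distrC (le_lt_trans xx).
have Ts : time_itv T s by rewrite time_itvE.
have Ts' : time_itv T s' by rewrite time_itvE.
have A := @horizontal_expansion u s' (x_ s') s s' (DH u s (win s)) (e / 2) C Ts' s0 ss' s'T.
have B := @time_expansion u (glue (pas s) (x_ s')) s s'
  (Dt T u s (win s)) (e / 2) C s0 ss' s'T.
have V := @vertical_expansion u s (x_ s) (x_ s') e C Ts.
have {}A := A _.
have {}B := B _ _.
have {}V := V _.
rewrite !glue_win in A B V.
set X1 := u s' (win s') - u s' (glue (pas s) (x_ s')) - DH u s (win s) * (s' - s) in A.
set X2 := u s' (glue (pas s) (x_ s')) - u s (glue (pas s) (x_ s'))
  - Dt T u s (win s) * (s' - s) in B.
set X3 := u s (glue (pas s) (x_ s')) - _ - _ - _ in V.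
rewrite (_ : u s' _ - _ - _ - _ - _ = X1 + X2 + X3); last by rewrite /X1 /X2 /X3; ring.
rewrite (_ : e * (s' - s) + _ =
  e / 2 * (s' - s) + e / 2 * (s' - s) + e * (x_ s' - x_ s) ^+ 2); last by lra.
apply: le_trans (ler_normD _ _) _; apply: lerD.
  apply: le_trans (ler_normD _ _) _; apply: lerD.
    apply: A => p p1 p2.
    have -> : DH u s (win s) =
        DH_tilde (tilde u) s (shift_past (T%:num - s) (pas T%:num)) (x_ s).
      by rewrite /DH win0 shift_pas ?subr_ge0// subKr.
    rewrite distrC; apply: (h1 s s' (T%:num - s) p) => //.
    - by rewrite subr_ge0 sT gerBl.
    - by rewrite (le_trans _ p1) ?subr_ge0//= (le_trans (ltW p2))// gerBl.
    - exact: bM.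
    - exact: bM.
    - exact: lt_le_trans nss rr1.
    - rewrite ger0_norm ?subr_ge0 ?(ltW p2)// (le_lt_trans _ (lt_le_trans sr rr1))//.
      by move: p1; lra.
    - exact: lt_le_trans nxx rr1.
  apply: B.
    apply: (within_continuous_comp (D := [set z : R * R * R | time_itv T z.1.1])
      (g := fun t => (t, s, x_ s'))
      (f := fun z : R * R * R => u z.1.1 (glue (pas z.1.2) z.2))) => //.
    - by apply: continuous_pair; [apply: continuous_pair|]; move=> t;
        [exact: cvg_id|exact: cvg_cst|exact: cvg_cst].
    - move=> t /=; rewrite in_itv/= time_itvE => /andP[st ts'].
      by rewrite (le_trans s0 st) (le_trans ts').
    - exact: functional_box_continuous.
  move=> t st ts'; rewrite -[X in _ - Dt _ _ _ X]glue_win.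
  apply: (h2 t s s s) => //.
  - by rewrite (le_trans s0 st) (le_trans (ltW ts')).
  - exact: bM.
  - exact: bM.
  - rewrite ger0_norm ?subr_ge0// (lt_le_trans _ rr2)// (le_lt_trans _ sr)//.
    by rewrite lerD2r ltW.
  - by rewrite subrr normr0.
  - by rewrite distrC (lt_le_trans nxx).
apply: V => z zx; rewrite -[X in _ - DVV _ _ X]glue_win.
apply: (h3 s s s s) => //.
- exact: range_triple (bM s) (bM s') zx.
- by apply: range_triple (bM s) (bM s') _; rewrite subrr normr0.
- by rewrite subrr normr0.
- by rewrite subrr normr0.
- by rewrite (le_lt_trans zx)// (le_lt_trans xx)// (lt_le_trans rr).
Qed.

End Expansion.

(** * Measurability of path functionals *)

Section Measurability.
Context {R : realType} (T : {posnum R}).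
Context d (Omega : measurableType d) (X : cprocess T Omega).

Lemma countable_bigcapT_measurable (I : Type) (F : I -> set Omega) :
  countable [set: I] -> (forall i, measurable (F i)) -> measurable (\bigcap_i F i).
Proof.
move=> cI mF; rewrite -[X in measurable X]setCK setC_bigcap; apply: measurableC.
by apply: countable_bigcupT_measurable => // i; exact: measurableC.
Qed.

Lemma clamp_time (s : R) : time_itv T (Num.min T%:num (Num.max 0 s)).
Proof. by rewrite time_itvE ge_min lexx /= andbT le_min ge0 le_max lexx. Qed.

Lemma stopped_measurable s : measurable_fun setT (stopped X s).
Proof. exact/(cprocess_meas X)/clamp_time. Qed.

Lemma stopped_close_measurable s s' (c : R) :
  measurable [set w | `|stopped X s w - stopped X s' w| <= c].
Proof.
have : measurable_fun setT (fun w => `|stopped X s w - stopped X s' w|).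
  apply: measurableT_comp => //.
  by apply: measurable_funB; exact: stopped_measurable.
move=> /(_ measurableT `]-oo, c]%classic (measurable_itv _)); rewrite setTI.
by congr measurable; apply/seteqP; split => w /=; rewrite in_itv.
Qed.

Lemma stopped_near_measurable s (a c : R) :
  measurable [set w | `|stopped X s w - a| <= c].
Proof.
have : measurable_fun setT (fun w => `|stopped X s w - a|).
  apply: measurableT_comp => //.
  by apply: measurable_funB; [exact: stopped_measurable|exact: measurable_cst].
move=> /(_ measurableT `]-oo, c]%classic (measurable_itv _)); rewrite setTI.
by congr measurable; apply/seteqP; split => w /=; rewrite in_itv.
Qed.

(* Countably many cells such that any two paths in the cell (n, m, c) are
   uniformly 6/(n+1)-close: the preimage of an open set under a continuous
   functional of the path is the union of the cells that it contains. *)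
Definition path_cell (z : nat * nat * seq rat) : set Omega :=
  let: (n, m, c) := z in
  (\bigcap_(q : rat * nat) [set w |
     `|ratr q.1 - q.2%:R / m.+1%:R| < 2 / m.+1%:R :> R ->
     `|stopped X (ratr q.1) w - stopped X (q.2%:R / m.+1%:R) w| <= n.+1%:R^-1]) `&`
  \bigcap_(k : nat) [set w | (k <= Num.trunc (T%:num * m.+1%:R))%N ->
     `|stopped X (k%:R / m.+1%:R) w - ratr (nth 0 c k)| <= n.+1%:R^-1].

Lemma path_cell_measurable z : measurable (path_cell z).
Proof.
move: z => [[n m] c]; apply: measurableI; apply: countable_bigcapT_measurable.
- exact: countableP.
- move=> [q k] /=.
  have [h|h] := pselect (`|ratr q - k%:R / m.+1%:R| < 2 / m.+1%:R :> R); last first.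
    by rewrite [X in measurable X](_ : _ = setT)//; apply/seteqP; split => w //= _ /h.
  rewrite [X in measurable X](_ : _ = [set w |
    `|stopped X (ratr q) w - stopped X (k%:R / m.+1%:R) w| <= n.+1%:R^-1]).
    exact: stopped_close_measurable.
  by apply/seteqP; split => w //=; exact.
- exact: countableP.
- move=> k /=; have [h|h] := boolP (k <= Num.trunc (T%:num * m.+1%:R))%N; last first.
    by rewrite [X in measurable X](_ : _ = setT)//; apply/seteqP;
      split => w //= _; rewrite (negbTE h).
  rewrite [X in measurable X](_ : _ = [set w |
    `|stopped X (k%:R / m.+1%:R) w - ratr (nth 0 c k)| <= n.+1%:R^-1]).
    exact: stopped_near_measurable.
  by apply/seteqP; split => w //=; exact.
Qed.

Lemma path_cell_cover n w : exists m c, path_cell (n, m, c) w.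
Proof.
have n0 : (0:R) < n.+1%:R^-1 by rewrite invr_gt0.
have [r r0 hr] := stopped_uniform X w n0.
(* The grid is so fine that [2 / m.+1] stays below the modulus of continuity of this path. *)
pose m := Num.trunc (2 / r).
have mr : 2 / m.+1%:R < r.
  rewrite ltr_pdivrMr// -ltr_pdivrMl// mulrC.
  by rewrite /m truncnS_gt.
exists m.
have H (k : nat) : exists c : rat, `|stopped X (k%:R / m.+1%:R) w - ratr c| <= n.+1%:R^-1.
  set y := stopped _ _ _.
  have : y < y + n.+1%:R^-1 by rewrite ltrDl.
  move=> /rat_in_itvoo[q]; rewrite in_itv/= => /andP[yq qy].
  by exists q; rewrite ler0_norm ?subr_le0 ?(ltW yq)// opprB lerBlDl ltW.
move: H => /choice[c hc].
exists (mkseq c (Num.trunc (T%:num * m.+1%:R)).+1); split.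
  by move=> [q k] _ /= qk; apply: hr; exact: lt_trans mr.
by move=> k _ /= km; rewrite nth_mkseq ?ltnS.
Qed.

(** Six errors of size [1 / n.+1]: each path spends two going from [s] to a grid point through a
    rational time, and one from its value there to the common rational number. *)
Lemma path_cell_close n m c w w' : path_cell (n, m, c) w -> path_cell (n, m, c) w' ->
  forall s, `|stopped X s w - stopped X s w'| <= 6 / n.+1%:R.
Proof.
move=> [A1 A2] [B1 B2] s.
have n0 : (0:R) < n.+1%:R^-1 by rewrite invr_gt0.
wlog Ts : s / time_itv T s.
  move=> /(_ _ (clamp_time s)); congr (`|_ - _| <= _);
    by rewrite stopped_id//; exact: clamp_time.
have := Ts; rewrite time_itvE => /andP[s0 sT].
pose k := Num.trunc (s * m.+1%:R).
have m0 : (0:R) < m.+1%:R by [].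
have km : (k <= Num.trunc (T%:num * m.+1%:R))%N.
  by rewrite /k; apply: le_truncn; rewrite ler_pM2r.
have sm0 : 0 <= s * m.+1%:R by rewrite mulr_ge0// ltW.
have /andP[k1 k2] := truncn_itv sm0.
have ks : 0 <= s - k%:R / m.+1%:R < m.+1%:R^-1.
  rewrite subr_ge0 ler_pdivrMr// k1/= ltrBlDr -[X in X + _]mul1r -mulrDl.
  by rewrite ltr_pdivlMr// nat1r.
have half v : path_cell (n, m, c) v ->
    `|stopped X s v - stopped X (k%:R / m.+1%:R) v| <= 2 / n.+1%:R.
  move=> [C1 _].
  have [r r0 hr] := stopped_uniform X v n0.
  (* The cell constrains rational times only. A rational within [1 / m.+1] to the right of [s] is
     within [2 / m.+1] of the grid point to the left of [s], which is the tolerance in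
     [path_cell]. *)
  have : s < s + Num.min r m.+1%:R^-1 by rewrite ltrDl lt_min r0 invr_gt0.
  move=> /rat_in_itvoo[q]; rewrite in_itv/= => /andP[sq].
  rewrite -ltrBlDl lt_min => /andP[qr qm].
  have /= C := C1 (q, k) I.
  have e1 : `|stopped X s v - stopped X (ratr q) v| <= n.+1%:R^-1.
    by apply: hr; rewrite distrC gtr0_norm ?subr_gt0.
  have e2 : `|stopped X (ratr q) v - stopped X (k%:R / m.+1%:R) v| <= n.+1%:R^-1.
    apply: C; move: ks qm => /andP[].
    move: (m.+1%:R^-1) (k%:R / m.+1%:R) => i p p1 p2 qm.
    by rewrite ger0_norm; lra.
  by rewrite -(subrKA (stopped X (ratr q) v)) (le_trans (ler_normD _ _))//; move: e1 e2;
    move: (n.+1%:R^-1) => i; lra.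
have := half _ (conj A1 A2); have := half _ (conj B1 B2).
have /= := A2 k I km; have /= := B2 k I km.
move: (n.+1%:R^-1) => i; rewrite !ler_norml.
by move=> /andP[? ?] /andP[? ?] /andP[? ?] /andP[? ?]; apply/andP; split; lra.
Qed.

(** Past and present are taken at separate times [s] and [a], because the quotients of the
    horizontal derivative shift the past and keep the present. *)
Lemma functional_glue_measurable (f : R -> bpath T -> R) t s a :
  continuous_on_domain f -> time_itv T t ->
  measurable_fun setT (fun w =>
    f t (glue (past_of (bpath_of_cpath (window X s w))) (stopped X a w))).
Proof.
move=> cf Tt; apply: (measurability _ (RGenOpens.measurableE R)).
move=> _ [_ [c1 [c2 ->]] <-]; rewrite setTI.
set g := fun w => _; set V := g @^-1` _.
have -> : V = \bigcup_(z : nat * nat * seq rat)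
    (if `[< path_cell z `<=` V >] then path_cell z else set0).
  apply/seteqP; split => [w Vw|w [z _]]; last by case: asboolP => // + Vw; apply.
  have : nbhs (glue (past_of (bpath_of_cpath (window X s w))) (stopped X a w))
      ((f t) @^-1` `]c1, c2[%classic).
    apply: functional_continuous => //; apply: open_nbhs_nbhs; split; last exact: Vw.
    exact: interval_open.
  move=> /bpath_sup_nbhs[r r0 hr].
  pose n := Num.trunc (6 / r).
  have nr : 6 / n.+1%:R < r.
    rewrite ltr_pdivrMr// -ltr_pdivrMl// mulrC.
    by rewrite /n truncnS_gt.
  have [m [c Aw]] := path_cell_cover n w.
  exists (n, m, c) => //; case: asboolP => // -[]; move=> w' Aw'.
  have close y : `|stopped X y w' - stopped X y w| <= r.
    by rewrite (le_trans (path_cell_close Aw' Aw _))// ltW.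
  apply: hr => x; rewrite window_itvE => /andP[Tx x0].
  have [->|xn0] := eqVneq x 0; first by rewrite !glue0.
  have px : past_itv T x by rewrite past_itvE Tx lt_neqAle xn0.
  by rewrite !glue_past// !pas_val.
apply: countable_bigcupT_measurable; first exact: countableP.
by move=> z; case: asboolP => // _; exact: path_cell_measurable.
Qed.

Lemma functional_win_measurable (f : R -> bpath T -> R) t s :
  continuous_on_domain f -> time_itv T t ->
  measurable_fun setT (fun w => f t (bpath_of_cpath (window X s w))).
Proof.
move=> cf Tt; under eq_fun do rewrite -glue_win.
exact: functional_glue_measurable.
Qed.

(** The horizontal derivative need not be continuous in the path, so cells do not apply to it
    directly. It is a limit of difference quotients with steps [1 / n.+1], whose shifted pasts are
    pasts at earlier times. *)
Lemma DH_win_measurable (u : R -> bpath T -> R) t : bpath_C12 u -> time_itv T t ->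
  measurable_fun setT (fun w => DH u t (bpath_of_cpath (window X t w))).
Proof.
move=> [cu _ [dH _] _] Tt.
pose pas s w := past_of (bpath_of_cpath (window X s w)).
apply: (@measurable_fun_cvg _ _ _ setT (fun n w =>
  (u t (glue (pas t w) (stopped X t w)) -
   u t (glue (pas (t - n.+1%:R^-1) w) (stopped X t w))) / n.+1%:R^-1)).
  move=> n; apply: measurable_funM; last exact: measurable_cst.
  by apply: measurable_funB; exact: functional_glue_measurable.
move=> w _.
have cH : quotient_H (tilde u) t (pas t w) (stopped X t w) @ 0^'+ -->
    DH u t (bpath_of_cpath (window X t w)).
  by rewrite -win0; exact: dH.
have ed : (n.+1%:R^-1 : R) @[n --> \oo] --> 0^'+.
  move=> A /= [r /= r0 hr]; have := @cvg_harmonic R; move/cvgrPdist_lt => /(_ _ r0).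
  by apply: filterS => n /= en; apply: hr.
have := cvg_comp _ _ ed cH; apply: cvg_trans; apply: near_eq_cvg; apply: nearW => n /=.
rewrite /quotient_H /tilde shift_pas//.
by move: Tt; rewrite time_itvE => /andP[].
Qed.

End Measurability.

(** * Measurability of time integrals *)

Section IntegralMeasurability.
Context {R : realType} d (Omega : measurableType d).
Notation leb := (@lebesgue_measure R).

Lemma integrable_within (f : R -> R) (t : R) :
  {within `[0, t], continuous f} -> leb.-integrable `[0, t] (EFin \o f).
Proof. by move=> cf; apply: continuous_compact_integrable => //; exact: segment_compact. Qed.

Lemma fine_lebesgue_itvoc (x y : R) : x <= y -> fine (leb `]x, y]) = y - x.
Proof.
rewrite lebesgue_measure_itv/= lte_fin le_eqVlt => /predU1P[->|xy].
  by rewrite ltxx subrr.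
by rewrite xy -EFinB.
Qed.

Lemma rssum_lebesgue_cvg (f : R -> R) (t : R) : 0 <= t ->
  {within `[0, t], continuous f} ->
  rssum f id t m @[m --> \oo] --> \int[leb]_(s in `[0, t]) f s.
Proof.
move=> t0 cf; apply/cvgrPdist_le => e e0.
have e't : 0 < e / (t + 1) by rewrite divr_gt0// ltr_wpDl.
have [N hN] := rssum_approx t0 cf e't.
exists N => // m /= Nm.
have iE : forall g : R -> R,
    {within `[0, t], continuous g} -> leb.-integrable `]0, t] (EFin \o g).
  move=> g cg; apply: integrableS (integrable_within cg) => //.
  by apply: subset_itvr; rewrite bnd_simp.
have f1 : (fun x => f x * 1) = f by apply/funext => x; rewrite mulr1.
have i1 : leb.-integrable `]0, t] (EFin \o (fun=> 1 : R)).
  by apply: iE; apply: continuous_subspaceT => x; exact: cvg_cst.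
have := hN m Nm leb (fun=> 1) id; rewrite f1 => /(_ (iE _ cf) i1 (fun _ _ => ler01)) H.
have {H} : `|rssum f id t m - \int[leb]_(x in `]0, t]) f x| <= e / (t + 1) * (t - 0).
  apply: H => x y x0 xy yt; rewrite Rintegral_cst//= mul1r.
  exact: fine_lebesgue_itvoc.
rewrite subr0 Rintegral_itv_obnd_cbnd; last exact: iE.
rewrite distrC => /le_trans; apply.
by rewrite mulrAC ler_pdivrMr ?ltr_wpDl// ler_pM2l// lerDl.
Qed.

(** Continuity in time makes the integral a pointwise limit of Riemann sums, each a finite
    combination of measurable functions of [w]. *)
Lemma Rintegral_measurable (f : R -> Omega -> R) (t : R) : 0 <= t ->
  (forall s, 0 <= s <= t -> measurable_fun setT (f s)) ->
  (forall w, {within `[0, t], continuous (f ^~ w)}) ->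
  measurable_fun setT (fun w => \int[leb]_(s in `[0, t]) f s w).
Proof.
move=> t0 mf cf.
apply: (@measurable_fun_cvg _ _ _ setT (fun m w => rssum (f ^~ w) id t m)); last first.
  by move=> w _; exact: rssum_lebesgue_cvg.
move=> m; rewrite /rssum; apply: measurable_sum => k.
apply: measurable_funM; last exact: measurable_cst.
apply: mf; rewrite mulr_ge0//= ?divr_ge0// ler_piMr// ler_pdivrMr// mul1r ler_nat.
by rewrite ltnW.
Qed.

End IntegralMeasurability.

(** * Convergence in probability *)

Section ConvergenceInProbability.
Context {R : realType} d (Omega : measurableType d) (P : probability Omega R).
Implicit Types (Z : R -> Omega -> R) (L : Omega -> R).

Definition deviation_set (f g : Omega -> R) (r : R) : set Omega :=
  [set w | r < `|f w - g w|].

Lemma deviation_set_measurable f g r : measurable_fun setT f ->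
  measurable_fun setT g -> measurable (deviation_set f g r).
Proof.
move=> mf mg; have : measurable_fun setT (fun w => `|f w - g w|).
  by apply: measurableT_comp => //; exact: measurable_funB.
move=> /(_ measurableT `]r, +oo[%classic (measurable_itv _)); rewrite setTI.
by congr measurable; apply/seteqP; split => w /=; rewrite in_itv/= andbT.
Qed.

Lemma cvg_in_probability_lt Z L (r e : R) : cvg_in_probability P 0^'+ Z L ->
  0 < r -> 0 < e ->
  \forall h \near 0^'+, measurable (deviation_set (Z h) L r) /\
    (P (deviation_set (Z h) L r) <= e%:E)%E.
Proof.
move=> [mZ mL] cZ r0 e0; have /fine_cvgP[ffin] := cZ r r0.
move=> /cvgrPdist_le /(_ e e0) H.
near=> h; split.
  by apply: deviation_set_measurable => //; near: h.
rewrite -[X in (X <= _)%E]fineK; last by near: h.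
rewrite lee_fin (le_trans (ler_norm _))// -normrN -sub0r; near: h; exact: H.
Unshelve. all: by end_near. Qed.

(* Borel-Cantelli: e_n is chosen in A so small that the n-th exceptional
   probabilities are at most 2^-(n+1). *)
Lemma in_probability_ae_subsequence (G : nat -> R -> Omega -> R)
    (H : nat -> Omega -> R) (A : set R) :
  (forall j, cvg_in_probability P 0^'+ (G j) (H j)) ->
  (forall r : R, 0 < r -> exists e, [/\ 0 < e, e < r & A e]) ->
  exists e_ : nat -> R, [/\ forall n, 0 < e_ n, e_ n @[n --> \oo] --> 0,
    forall n, A (e_ n) &
    {ae P, forall w, forall j, G j (e_ n) w @[n --> \oo] --> H j w}].
Proof.
move=> cG hA.
(* A diagonal choice: the n-th step controls the finitely many indices [j <= n], so that one
   sequence serves all [j]. *)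
have ex n : exists e, [/\ 0 < e, e < n.+1%:R^-1, A e &
    forall j, (j <= n)%N -> measurable (deviation_set (G j e) (H j) n.+1%:R^-1) /\
      (P (deviation_set (G j e) (H j) n.+1%:R^-1) <= (1 / (2 ^ n.+1)%:R)%:E)%E].
  have n0 : (0:R) < n.+1%:R^-1 by rewrite invr_gt0.
  have p0 : (0:R) < 1 / (2 ^ n.+1)%:R by rewrite divr_gt0// ltr0n expn_gt0.
  have : \forall e \near (0:R)^'+, forall j : 'I_n.+1,
      measurable (deviation_set (G j e) (H j) n.+1%:R^-1) /\
      (P (deviation_set (G j e) (H j) n.+1%:R^-1) <= (1 / (2 ^ n.+1)%:R)%:E)%E.
    by apply: filter_forall => j; exact: cvg_in_probability_lt.
  move=> [r /= r0 hr].
  have rn : 0 < Num.min r n.+1%:R^-1 by rewrite lt_min r0.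
  have [e [e0]] := hA _ rn; rewrite lt_min => /andP[er en] Ae.
  exists e; split => // j jn.
  have := hr e; rewrite /ball_/= sub0r normrN gtr0_norm//
    => /(_ er e0 (Ordinal (n:=n.+1) (m:=j) jn)).
  exact.
move: ex => /choice[e_ he]; exists e_; split.
- by move=> n; case: (he n).
- apply: (@squeeze_cvgr _ _ _ _ (fun=> 0) (fun n => n.+1%:R^-1)).
  + by apply: nearW => n; case: (he n) => e0 en _ _; rewrite !ltW.
  + exact: cvg_cst.
  + exact: cvg_harmonic.
- by move=> n; case: (he n).
- apply/ae_foralln => j.
  (* Index [j] is controlled only from [n = j] on; the earlier sets are replaced by empty ones,
     which changes no limit. *)
  pose F n := if (j <= n)%N then deviation_set (G j (e_ n)) (H j) n.+1%:R^-1 else set0.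
  have mF n : measurable (F n).
    by rewrite /F; case: ifPn => // jn; have [_ _ _ /(_ _ jn)[]] := he n.
  have sF : (\sum_(n <oo) P (F n) < +oo)%E.
    apply: (@le_lt_trans _ _ 1%:E); last exact: ltry.
    apply: le_trans (epsilon_trick0 xpredT ler01).
    apply: lee_nneseries => // n _; rewrite /F; case: ifPn => jn.
      by have [_ _ _ /(_ _ jn)[]] := he n.
    by rewrite measure0 lee_fin divr_ge0.
  exists (lim_sup_set F); split.
  + by apply: bigcap_measurable => // k _; exact: bigcup_measurable.
  + exact: lim_sup_set_cvg0.
  move=> w /=; apply: contra_notP; rewrite /lim_sup_set /bigcap/= => /existsNP[N].
  rewrite not_implyE => -[_] hN; apply/cvgrPdist_le => r r0.
  near=> n.
  have jn : (j <= n)%N by near: n; exists j.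
  have Nn : (N <= n)%N by near: n; exists N.
  rewrite (@le_trans _ _ n.+1%:R^-1)//.
    rewrite leNgt distrC; apply/negP => C; apply: hN.
    by exists n => //; rewrite /F jn.
  near: n; have := @cvg_harmonic R => /cvgrPdist_le /(_ _ r0).
  apply: filterS => n /=; rewrite sub0r normrN ger0_norm//.
Unshelve. all: by end_near. Qed.

(** Subsequence principle: if [Z] failed to converge, deviations of probability above some [e] would
    occur at arbitrarily small steps. A sequence extracted from these steps makes all [G j] converge
    almost surely, hence [Z] as well, which forces the deviation probabilities to 0. *)
Lemma cvg_in_probability_transfer (G : nat -> R -> Omega -> R)
    (H : nat -> Omega -> R) Z L :
  (forall j, cvg_in_probability P 0^'+ (G j) (H j)) ->
  (\forall h \near 0^'+, measurable_fun setT (Z h)) -> measurable_fun setT L ->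
  {ae P, forall w, forall e_ : nat -> R, (forall n, 0 < e_ n) ->
    e_ n @[n --> \oo] --> 0 ->
    (forall j, G j (e_ n) w @[n --> \oo] --> H j w) ->
    Z (e_ n) w @[n --> \oo] --> L w} ->
  cvg_in_probability P 0^'+ Z L.
Proof.
move=> cG mZ mL ZL; split => // r r0.
have mD : \forall h \near 0^'+, measurable (deviation_set (Z h) L r).
  by apply: filterS mZ => h mZ; exact: deviation_set_measurable.
apply/fine_cvgP; split.
  by apply: filterS mD => h mD; exact: fin_num_measure.
apply/cvgrPdist_le => e e0; apply: contrapT => nH.
pose A h := measurable_fun setT (Z h) /\ (e%:E < P (deviation_set (Z h) L r))%E.
have hA q : 0 < q -> exists h, [/\ 0 < h, h < q & A h].
  move=> q0; apply: contrapT => nE; apply: nH.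
  near=> h.
  have mDh : measurable (deviation_set (Z h) L r) by near: h.
  have mZh : measurable_fun setT (Z h) by near: h.
  have h0 : 0 < h by near: h; exact: nbhs_right_gt.
  have hq : h < q by near: h; exact: nbhs_right_lt.
  rewrite sub0r normrN ger0_norm; last by rewrite fine_ge0.
  rewrite -lee_fin fineK; last exact: fin_num_measure.
  rewrite leNgt; apply/negP => C; apply: nE; exists h; split => //.
have [e_ [e_0 e_c Ae aeG]] := in_probability_ae_subsequence cG hA.
pose F n := deviation_set (Z (e_ n)) L r.
have mF n : measurable (F n) by apply: deviation_set_measurable => //; case: (Ae n).
have PF : (P (\bigcup_(k >= 0%N) F k) < +oo)%E.
  rewrite (le_lt_trans (probability_le1 _ _)) ?ltry//.
  exact: bigcup_measurable.
have mlim : measurable (lim_sup_set F).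
  by apply: bigcap_measurable => // k _; exact: bigcup_measurable.
(* A point of this set deviates by more than [r] infinitely often, so [Z] cannot converge there. *)
have l0 : P (lim_sup_set F) = 0%E.
  apply/(negligibleP P mlim).
  have aeB : P.-negligible (~` (_ `&` _)) := filterI ZL aeG.
  apply: negligibleS (aeB _).
  move=> w /= lw [zl hw]; have := zl e_ e_0 e_c hw.
  move=> /cvgrPdist_lt /(_ _ r0) [N _ hN].
  have [n /= Nn] := lw N I.
  by rewrite /F /deviation_set/= distrC => /lt_trans - /(_ _ (hN n Nn)); rewrite ltxx.
have cF : P (\bigcup_(k >= n) F k) @[n --> \oo] --> P (lim_sup_set F).
  exact: lim_sup_set_cvg.
rewrite l0 in cF; move: cF => /fine_cvgP[_].
move=> /cvgrPdist_lt /(_ _ e0)[N _ /(_ N (leqnn N))] /=.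
rewrite sub0r normrN ger0_norm ?fine_ge0// => C.
have [_] := Ae N; rewrite ltNge => /negP; apply.
have mU : measurable (\bigcup_(k >= N) F k) by exact: bigcup_measurable.
rewrite (@le_trans _ _ (P (\bigcup_(k >= N) F k)))//.
  by apply: le_measure; rewrite ?inE//; [exact: mF|move=> w Fw; exists N => /=].
by rewrite -[X in (X <= _)%E]fineK ?fin_num_measure// lee_fin ltW.
Unshelve. all: by end_near. Qed.

End ConvergenceInProbability.

(** * The pathwise limit *)

Section Primitives.
Context {R : realType}.
Notation leb := (@lebesgue_measure R).
Implicit Types f F : R -> R.

(** Integrating from -1 makes 0 an interior point, so the derivative at 0 is two-sided. *)
Lemma primitive_exists f : continuous f ->
  exists F, forall x : R, - 1 < x -> is_derive x 1 F (f x).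
Proof.
move=> cf; exists (fun x => \int[leb]_(t in `[- 1, x]) f t) => x x1.
have xx : x < x + 1 by rewrite ltrDl.
have fi : leb.-integrable `[- 1, x + 1] (EFin \o f).
  apply: continuous_compact_integrable; first exact: segment_compact.
  exact: continuous_subspaceT.
have [dF <-] := continuous_FTC1_closed xx fi x1 (cf x).
by rewrite derive1E; exact: DeriveDef.
Qed.

Lemma Rintegral_primitive f F a b : continuous f ->
  (forall x : R, - 1 < x -> is_derive x 1 F (f x)) -> 0 <= a -> a <= b ->
  \int[leb]_(x in `[a, b]) f x = F b - F a.
Proof.
move=> cf dF a0; rewrite le_eqVlt => /predU1P[->|ab].
  by rewrite set_itv1 Rintegral_set1 subrr.
have cF x : - 1 < x -> {for x, continuous F}.
  move=> x1; apply/differentiable_continuous/derivable1_diffP.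
  exact: (@ex_derive _ _ _ _ _ _ _ (dF x x1)).
have a1 : - 1 < a by rewrite (lt_le_trans _ a0)// ltrN10.
have b1 : - 1 < b by rewrite (lt_trans a1).
rewrite /Rintegral (@continuous_FTC2 _ f F)//.
- exact: continuous_subspaceT.
- split.
  + move=> x; rewrite in_itv/= => /andP[ax _].
    exact: (@ex_derive _ _ _ _ _ _ _ (dF x (lt_trans a1 ax))).
  + by apply: cvg_at_right_filter; exact: cF.
  + by apply: cvg_at_left_filter; exact: cF.
- move=> x; rewrite in_itv/= => /andP[ax _].
  by rewrite derive1E; apply: (@derive_val _ _ _ _ _ _ _ (dF x (lt_trans a1 ax))).
Qed.

(** In terms of a primitive, the average is a difference quotient at [t] minus one at 0. *)
Lemma increment_mean_cvg f (t : R) (e_ : nat -> R) : continuous f -> 0 <= t ->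
  (forall n, 0 < e_ n) -> e_ n @[n --> \oo] --> 0 ->
  (e_ n)^-1 * \int[leb]_(s in `[0, t]) (f (s + e_ n) - f s) @[n --> \oo] -->
    f t - f 0.
Proof.
move=> cf t0 e0 ec; have [F dF] := primitive_exists cf.
have E n : (e_ n)^-1 * \int[leb]_(s in `[0, t]) (f (s + e_ n) - f s) =
    (e_ n)^-1 * (F (e_ n + t) - F t) - (e_ n)^-1 * (F (e_ n + 0) - F 0).
  have cfe : continuous (fun s => f (s + e_ n) - f s).
    move=> x; apply: cvgB; last exact: cf.
    apply: (@continuous_comp _ _ _ (fun s => s + e_ n) f); last exact: cf.
    by apply: cvgD; [exact: cvg_id|exact: cvg_cst].
  have dFe (x : R) : - 1 < x ->
      is_derive x 1 (fun s => F (s + e_ n) - F s) (f (x + e_ n) - f x).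
    move=> x1; have xe : - 1 < x + e_ n by rewrite (lt_trans x1)// ltrDl.
    have h1 := dF x x1; have h2 := dF _ xe.
    have h3 : is_derive x 1 (fun s => F (s + e_ n)) (f (x + e_ n)).
      have h4 : is_derive x 1 (fun s : R => s + e_ n) 1.
        by apply: is_derive_eq; rewrite addr0.
      have := @is_derive1_comp _ F (fun s : R => s + e_ n) x _ _ h2 h4.
      by rewrite mulr1.
    exact: is_deriveB.
  rewrite (Rintegral_primitive cfe dFe (lexx 0) t0) -mulrBr !(addrC (e_ n)).
  by congr (_ * _); ring.
have D x : 0 <= x -> (e_ n)^-1 * (F (e_ n + x) - F x) @[n --> \oo] --> f x.
  move=> x0; have x1 : - 1 < x by rewrite (lt_le_trans _ x0)// ltrN10.
  have h := dF x x1.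
  have := @ex_derive _ _ _ _ _ _ _ h.
  have := @derive_val _ _ _ _ _ _ _ h; rewrite /derive /derivable => vE /= cv.
  have {}cv : h0^-1 *: (F (h0 *: 1 + x) - F x) @[h0 --> 0^'] --> f x by rewrite -vE.
  have ed : e_ n @[n --> \oo] --> 0^'.
    move=> A /= [r /= r0 hr]; move/cvgrPdist_lt : ec => /(_ _ r0).
    by apply: filterS => n /= en; apply: hr => //=; rewrite gt_eqF.
  have := cvg_comp _ _ ed cv.
  by apply: cvg_trans; apply: near_eq_cvg; apply: nearW => n /=; rewrite /GRing.scale/= mulr1.
under eq_fun do rewrite E.
by apply: cvgB; exact: D.
Qed.

End Primitives.

Section PathwiseLimit.
Context {R : realType}.
Notation leb := (@lebesgue_measure R).

(** Both integrals are close to Riemann-Stieltjes sums over one fixed partition, and these sums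
    converge because they involve the distribution functions at finitely many points only. *)
Lemma stieltjes_limit (t : R) (Z : R -> R) (h : nat -> R -> R)
    (mu : {measure set (measurableTypeR R) -> \bar R}) (Q : R -> R) :
  0 <= t -> {within `[0, t], continuous Z} ->
  (forall n, {within `[0, t], continuous (h n)}) ->
  (forall n s, 0 <= s <= t -> 0 <= h n s) ->
  mu.-integrable `]0, t] (EFin \o Z) ->
  mu.-integrable `]0, t] (EFin \o (fun=> 1)) ->
  (forall x y, 0 <= x -> x <= y -> y <= t -> fine (mu `]x, y]%classic) = Q y - Q x) ->
  (forall m k, (k <= m.+1)%N ->
    \int[leb]_(s in `[0, t * (k%:R / m.+1%:R)]) h n s @[n --> \oo] -->
      Q (t * (k%:R / m.+1%:R))) ->
  \int[leb]_(s in `[0, t]) (Z s * h n s) @[n --> \oo] -->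
    \int[mu]_(s in `]0, t]) Z s.
Proof.
move=> t0 cZ ch h0 iZ i1 mQ cQ.
pose G n q := \int[leb]_(s in `[0, q]) h n s.
have tE m : t * (m.+1%:R / m.+1%:R) = t by rewrite divff ?mulr1// pnatr_eq0.
have t0E (m : nat) : t * (0%:R / m.+1%:R) = 0 by rewrite mul0r mulr0.
have Q0 : 0 <= Q t - Q 0 by rewrite -mQ// fine_ge0.
(* Strictly above the limiting mass, hence eventually above the approximating masses too; each of
   the three errors is then at most [e / 3]. *)
pose B := Q t - Q 0 + 1.
have B0 : 0 < B by rewrite ltr_wpDl.
apply/cvgrPdist_le => e e0.
have e'0 : 0 < e / (3 * B) by rewrite divr_gt0// mulr_gt0.
have [m0 hm] := rssum_approx t0 cZ e'0.
have cG m k : (k <= m.+1)%N ->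
    G n (t * (k%:R / m.+1%:R)) @[n --> \oo] --> Q (t * (k%:R / m.+1%:R)).
  exact: cQ.
have cS : rssum Z (G n) t m0 @[n --> \oo] --> rssum Z Q t m0.
  apply: cvg_big => [|k _]; first exact: add_continuous.
  apply: cvgM; first exact: cvg_cst.
  by apply: cvgB; apply: cG => //; exact: ltnW.
have cB : G n t - G n 0 @[n --> \oo] --> Q t - Q 0.
  by apply: cvgB; [have := cG 0%N 1%N isT; rewrite tE|have := cG 0%N 0%N isT; rewrite t0E].
have e30 : 0 < e / 3 by rewrite divr_gt0.
move/cvgrPdist_le : cS => /(_ _ e30) cS.
have B1 : Q t - Q 0 < B by rewrite ltrDl.
move/(cvgr_le (Q t - Q 0)) : cB => /(_ _ B1) cB.
near=> n.
have hS : `|rssum Z Q t m0 - rssum Z (G n) t m0| <= e / 3 by near: n.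
have hB : G n t - G n 0 <= B by near: n.
have sub x : 0 <= x -> x <= t -> `[0, x] `<=` `[0, t].
  by move=> x0 xt; apply: subset_itvl; rewrite bnd_simp.
have ioc f : {within `[0, t], continuous f} -> leb.-integrable `]0, t] (EFin \o f).
  move=> cf; apply: integrableS (integrable_within cf) => //.
  by apply: subset_itvr; rewrite bnd_simp.
have cZh : {within `[0, t], continuous (fun s => Z s * h n s)}.
  move/subspace_continuousP : cZ => cZ; have /subspace_continuousP ch' := ch n.
  apply/subspace_continuousP => s st; apply: cvgM; [exact: cZ|exact: ch'].
have A1 := hm m0 (leqnn _) leb (h n) (G n) (ioc _ cZh) (ioc _ (ch n)).
have {}A1 : `|rssum Z (G n) t m0 - \int[leb]_(s in `]0, t]) (Z s * h n s)| <=
    e / (3 * B) * (G n t - G n 0).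
  apply: A1.
    by move=> x /=; rewrite in_itv/= => /andP[x0 xt]; rewrite h0// ltW.
  move=> x y x0 xy yt; apply/esym.
  apply: (@Rintegral_itvB _ (h n) (BLeft 0) (BRight y) x); rewrite ?bnd_simp//.
  apply: integrableS (integrable_within (ch n)) => //.
  by apply: sub => //; exact: le_trans xy.
have A2 : `|rssum Z Q t m0 - \int[mu]_(s in `]0, t]) (Z s * 1)| <=
    e / (3 * B) * (Q t - Q 0).
  apply: hm => //.
    by rewrite (_ : (fun x => Z x * 1) = Z)//; apply/funext => x; rewrite mulr1.
  by move=> x y x0 xy yt; rewrite Rintegral_cst ?mul1r ?mQ.
have Z1 : (fun x => Z x * 1) = Z by apply/funext => x; rewrite mulr1.
rewrite Z1 in A2.
rewrite Rintegral_itv_obnd_cbnd in A1; last exact: ioc.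
have b1 : e / (3 * B) * (G n t - G n 0) <= e / 3.
  rewrite (le_trans (ler_wpM2l (ltW e'0) hB))// le_eqVlt; apply/orP; left; apply/eqP.
  by field; rewrite gt_eqF.
have b2 : e / (3 * B) * (Q t - Q 0) <= e / 3.
  rewrite (le_trans (ler_wpM2l (ltW e'0) (ltW B1)))// le_eqVlt; apply/orP; left; apply/eqP.
  by field; rewrite gt_eqF.
have := le_trans A1 b1; have := le_trans A2 b2; move: hS.
rewrite !ler_norml => /andP[? ?] /andP[? ?] /andP[? ?]; apply/andP; split; lra.
Unshelve. all: by end_near. Qed.

Lemma within_continuousM (A : set R) (f g : R -> R) :
  {within A, continuous f} -> {within A, continuous g} ->
  {within A, continuous (fun x => f x * g x)}.
Proof.
move=> /subspace_continuousP cf /subspace_continuousP cg.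
by apply/subspace_continuousP => s As; apply: cvgM; [exact: cf|exact: cg].
Qed.

Lemma within_continuousB (A : set R) (f g : R -> R) :
  {within A, continuous f} -> {within A, continuous g} ->
  {within A, continuous (fun x => f x - g x)}.
Proof.
move=> /subspace_continuousP cf /subspace_continuousP cg.
by apply/subspace_continuousP => s As; apply: cvgB; [exact: cf|exact: cg].
Qed.

Lemma clamp_continuous (T : R) : continuous (fun s : R => Num.min T (Num.max 0 s)).
Proof.
move=> x; apply: (@continuous_min R R (fun=> T) (fun y => Num.max 0 y) x).
  exact: cvg_cst.
by apply: (@continuous_max R R (fun=> 0) id x); [exact: cvg_cst|exact: cvg_id].
Qed.

(** After division by [e_ n] and integration of the expansion, the increments of [v] and the squared
    increments of [x] have known limits, so the remaining term, the forward sum, converges to what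
    is left. *)
Lemma pathwise_forward_limit (T t : R) (x v b Y Z : R -> R) (e_ : nat -> R)
    (mu : {measure set (measurableTypeR R) -> \bar R}) (Q : R -> R) :
  0 <= t -> t <= T -> continuous x ->
  (forall s, x s = x (Num.min T (Num.max 0 s))) ->
  {within `[0, T], continuous v} -> {within `[0, T], continuous b} ->
  {within `[0, T], continuous Y} -> {within `[0, T], continuous Z} ->
  (forall e : R, 0 < e -> exists2 r : R, 0 < r &
    forall s s', 0 <= s -> s <= s' -> s' <= T -> s' - s < r ->
    `|v s' - v s - b s * (s' - s) - Y s * (x s' - x s)
      - 2^-1 * Z s * (x s' - x s) ^+ 2| <= e * (s' - s) + e * (x s' - x s) ^+ 2) ->
  (forall n, 0 < e_ n) -> e_ n @[n --> \oo] --> 0 ->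
  mu.-integrable `]0, t] (EFin \o Z) ->
  mu.-integrable `]0, t] (EFin \o (fun=> 1)) ->
  (forall x y, 0 <= x -> x <= y -> y <= t -> fine (mu `]x, y]%classic) = Q y - Q x) ->
  (forall m k, (k <= m.+1)%N ->
    (e_ n)^-1 * \int[leb]_(s in `[0, t * (k%:R / m.+1%:R)]) (x (s + e_ n) - x s) ^+ 2
      @[n --> \oo] --> Q (t * (k%:R / m.+1%:R))) ->
  \int[leb]_(s in `[0, t]) (Y s * ((x (s + e_ n) - x s) / e_ n)) @[n --> \oo] -->
    v t - v 0 - \int[leb]_(s in `[0, t]) b s - 2^-1 * \int[mu]_(s in `]0, t]) Z s.
Proof.
move=> t0 tT cx xcl cv cb cY cZ expan e0 ec iZ i1 mQ cQ.
have T0 : 0 <= T by exact: le_trans tT.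
pose cl (s : R) := Num.min T (Num.max 0 s).
have clT s : `[0, T]%classic (cl s).
  by rewrite /= in_itv/= /cl ge_min lexx /= andbT le_min T0 le_max lexx.
have cl_id s : 0 <= s -> s <= T -> cl s = s.
  by move=> s0 sT; rewrite /cl (max_idPr s0) (min_idPr sT).
have ccl (f : R -> R) : {within `[0, T], continuous f} -> continuous (f \o cl).
  move=> cf; apply/continuous_subspace_setT.
  by apply: within_continuous_comp cf; [exact: clamp_continuous|move=> s _; exact: clT].
have sub q : q <= T -> `[0, q] `<=` `[0, T].
  by move=> qT; apply: subset_itvl; rewrite bnd_simp.
have [F dF] := primitive_exists (ccl _ cb).
(* Subtracting a primitive of [b] absorbs the drift; clamping extends the result to all times, as
   for [x]. *)
pose g s := v (cl s) - F (cl s).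
have cg : continuous g.
  move=> s; apply: cvgB; first exact: (ccl _ cv).
  apply: (@continuous_comp _ _ _ cl F); first exact: clamp_continuous.
  apply/differentiable_continuous/derivable1_diffP.
  have cl1 : - 1 < cl s.
    by have := clT s; rewrite /= in_itv/= => /andP[c0 _]; rewrite (lt_le_trans _ c0)// ltrN10.
  exact: (@ex_derive _ _ _ _ _ _ _ (dF (cl s) cl1)).
have -> : v t - v 0 - \int[leb]_(s in `[0, t]) b s = g t - g 0.
  have -> : \int[leb]_(s in `[0, t]) b s = \int[leb]_(s in `[0, t]) (b \o cl) s.
    apply: eq_Rintegral => s; rewrite inE/= in_itv/= => /andP[s0 st] /=.
    by rewrite cl_id// (le_trans st).
  rewrite (Rintegral_primitive (ccl _ cb) dF (lexx 0) t0) /g !cl_id//.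
  by ring.
pose h n s := (e_ n)^-1 * (x (s + e_ n) - x s) ^+ 2.
have cD n : continuous (fun s => x (s + e_ n) - x s).
  move=> s; apply: cvgB; last exact: cx.
  apply: (@continuous_comp _ _ _ (fun s => s + e_ n) x); last exact: cx.
  by apply: cvgD; [exact: cvg_id|exact: cvg_cst].
have cD2 n : continuous (fun s => (x (s + e_ n) - x s) ^+ 2).
  by move=> s; apply: cvgM; exact: cD.
have ch n : continuous (h n).
  by move=> s; apply: cvgM; [exact: cvg_cst|exact: cD2].
have h0 n s : 0 <= h n s by rewrite mulr_ge0 ?sqr_ge0// invr_ge0 ltW.
have hE n q : \int[leb]_(s in `[0, q]) h n s =
    (e_ n)^-1 * \int[leb]_(s in `[0, q]) (x (s + e_ n) - x s) ^+ 2.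
  rewrite RintegralZl//; apply: integrable_within.
  exact: continuous_subspaceT.
have cZt := continuous_subspaceW (sub _ tT) cZ.
have cYt := continuous_subspaceW (sub _ tT) cY.
have cC : \int[leb]_(s in `[0, t]) (Z s * h n s) @[n --> \oo] --> \int[mu]_(s in `]0, t]) Z s.
  apply: (stieltjes_limit t0 cZt _ _ iZ i1 mQ).
  - by move=> n; apply: continuous_subspaceT.
  - by move=> n s _.
  - by move=> m k km; under eq_fun do rewrite hE; exact: cQ.
have cA := increment_mean_cvg cg t0 e0 ec.
have cH : \int[leb]_(s in `[0, t]) h n s @[n --> \oo] --> Q t.
  under eq_fun do rewrite hE.
  by have := cQ 0%N 1%N isT; rewrite divff// mulr1.
pose a n s := (e_ n)^-1 * (g (s + e_ n) - g s).
pose y n s := Y s * ((x (s + e_ n) - x s) / e_ n).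
have ca n : {within `[0, t], continuous (a n)}.
  apply: continuous_subspaceT => s; apply: cvgM; first exact: cvg_cst.
  apply: cvgB; last exact: cg.
  apply: (@continuous_comp _ _ _ (fun s => s + e_ n) g); last exact: cg.
  by apply: cvgD; [exact: cvg_id|exact: cvg_cst].
have cy n : {within `[0, t], continuous (y n)}.
  apply: within_continuousM => //.
  by apply: continuous_subspaceT => s; apply: cvgM; [exact: cD|exact: cvg_cst].
have cz n : {within `[0, t], continuous (fun s => Z s * h n s)}.
  by apply: within_continuousM => //; exact: continuous_subspaceT.
have cz2 n : {within `[0, t], continuous (fun s => 2^-1 * (Z s * h n s))}.
  by apply: within_continuousM => //; apply: continuous_subspaceT => s; exact: cvg_cst.
have cay n := within_continuousB (ca n) (cy n).
have cr n := within_continuousB (cay n) (cz2 n).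
(* The averaged remainder of the expansion. Once it tends to 0, the forward sum is a combination of
   convergent sequences. *)
pose D n := \int[leb]_(s in `[0, t]) (a n s - y n s - 2^-1 * (Z s * h n s)).
have DE n : D n = (e_ n)^-1 * \int[leb]_(s in `[0, t]) (g (s + e_ n) - g s)
    - \int[leb]_(s in `[0, t]) y n s - 2^-1 * \int[leb]_(s in `[0, t]) (Z s * h n s).
  rewrite /D (RintegralB _ (integrable_within (cay n)) (integrable_within (cz2 n)))//.
  rewrite (RintegralB _ (integrable_within (ca n)) (integrable_within (cy n)))//.
  rewrite (RintegralZl _ _ (integrable_within (cz n)))// RintegralZl//.
  apply: integrable_within; apply: continuous_subspaceT => s.
  apply: cvgB; last exact: cg.
  apply: (@continuous_comp _ _ _ (fun s => s + e_ n) g); last exact: cg.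
  by apply: cvgD; [exact: cvg_id|exact: cvg_cst].
suff cD0 : D n @[n --> \oo] --> 0.
  have cC2 : 2^-1 * \int[leb]_(s in `[0, t]) (Z s * h n s) @[n --> \oo] -->
      2^-1 * \int[mu]_(s in `]0, t]) Z s.
    by apply: cvgM; [exact: cvg_cst|exact: cC].
  rewrite -[X in _ --> X]subr0.
  rewrite [X in X @ _ --> _](_ : _ = fun n =>
    (e_ n)^-1 * \int[leb]_(s in `[0, t]) (g (s + e_ n) - g s)
    - 2^-1 * \int[leb]_(s in `[0, t]) (Z s * h n s) - D n).
    by apply: cvgB => //; apply: cvgB.
  by apply/funext => n; rewrite DE /y; ring.
apply/cvgrPdist_le => e ee0.
(* Dominates [t] plus the eventual bound on the integral of [h n], so that the total error is at
   most [q * B = e]. *)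
pose B := `|Q t| + 1 + t + 1.
have B0 : 0 < B by rewrite /B; have := normr_ge0 (Q t); lra.
pose q := e / B.
have q0 : 0 < q by rewrite divr_gt0.
have q20 : 0 < q / 2 by rewrite divr_gt0.
have [r1 r10 hr1] := expan _ q20.
have [r2 r20 hr2] := compact_uniform_continuous (@segment_compact _ 0 T) cb q20.
have QB : Q t < `|Q t| + 1 by rewrite (le_lt_trans (ler_norm _))// ltrDl.
move/(cvgr_le (Q t)) : cH => /(_ _ QB) cH.
near=> n.
have hH : \int[leb]_(s in `[0, t]) h n s <= `|Q t| + 1 by near: n.
have en : e_ n < Num.min r1 r2.
  near: n; have r0 : 0 < Num.min r1 r2 by rewrite lt_min r10.
  move/cvgrPdist_lt : ec => /(_ _ r0); apply: filterS => n.
  by rewrite sub0r normrN gtr0_norm.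
move: en; rewrite lt_min => /andP[en1 en2].
have bound s : `[0, t]%classic s ->
    `|a n s - y n s - 2^-1 * (Z s * h n s)| <= q + q * h n s.
  rewrite /= in_itv/= => /andP[s0 st].
  have sT : s <= T by exact: le_trans tT.
  have en0 := e0 n.
  (* The time [s + e_ n] may exceed T. Clamping changes neither [x] nor [g] and leaves
     [s' - s <= e_ n]. *)
  pose s' := cl (s + e_ n).
  have s'T : s' <= T by have := clT (s + e_ n); rewrite /= in_itv/= => /andP[].
  have ss' : s <= s'.
    by rewrite /s' /cl le_min sT le_max lerDl (ltW en0) orbT.
  have s'e : s' - s <= e_ n.
    by rewrite lerBlDl /s' /cl ge_min ge_max lexx andbT addr_ge0 ?orbT// ltW.
  have gs : g s = v s - F s by rewrite /g cl_id.
  have gs' : g (s + e_ n) = v s' - F s' by [].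
  have xs' : x (s + e_ n) = x s' by rewrite xcl.
  have E1 := hr1 s s' s0 ss' s'T (le_lt_trans s'e en1).
  have E2 : `|F s' - F s - b s * (s' - s)| <= q / 2 * (s' - s).
    have dFm z : z \in `]s, s'[%R -> is_derive z 1 F ((b \o cl) z).
      rewrite in_itv/= => /andP[sz _]; apply: dF.
      by rewrite (lt_trans _ sz)// (lt_le_trans _ s0)// ltrN10.
    have cFm : {within `[s, s'], continuous F}.
      apply: derivable_within_continuous => z; rewrite in_itv/= => /andP[sz _].
      have z1 : - 1 < z by rewrite (lt_le_trans _ sz)// (lt_le_trans _ s0)// ltrN10.
      exact: (@ex_derive _ _ _ _ _ _ _ (dF z z1)).
    have [c] := MVT_segment ss' dFm cFm.
    rewrite in_itv/= => /andP[sc cs'] ->.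
    have c0 : 0 <= c by exact: le_trans sc.
    have cT : c <= T by exact: le_trans s'T.
    rewrite /= cl_id// -mulrBl normrM (ger0_norm (x := s' - s)) ?subr_ge0//.
    rewrite ler_wpM2r ?subr_ge0//; apply: hr2; rewrite /= ?in_itv/= ?c0 ?s0//.
    rewrite -ball_normE/= ger0_norm ?subr_ge0// (le_lt_trans _ (le_lt_trans s'e en2))//.
    by rewrite lerD2r.
  rewrite /a /y /h gs gs' xs'.
  rewrite (_ : _ - _ - _ = (e_ n)^-1 *
    ((v s' - v s - b s * (s' - s) - Y s * (x s' - x s) - 2^-1 * Z s * (x s' - x s) ^+ 2)
     - (F s' - F s - b s * (s' - s)))); last by ring.
  rewrite normrM gtr0_norm ?invr_gt0// mulrC ler_pdivrMr// mulrDl.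
  rewrite (_ : q * ((e_ n)^-1 * _) * e_ n = q * (x s' - x s) ^+ 2); last first.
    by field; rewrite gt_eqF.
  apply: le_trans (ler_normB _ _) _; apply: le_trans (lerD E1 E2) _.
  have : q * (s' - s) <= q * e_ n by rewrite ler_pM2l.
  have := sqr_ge0 (x s' - x s); set w := _ ^+ 2 => w0.
  have : 0 <= q * w by rewrite mulr_ge0// ltW.
  lra.
rewrite sub0r normrN /D.
have ih : leb.-integrable `[0, t] (EFin \o h n).
  by apply: integrable_within; exact: continuous_subspaceT.
have iq : leb.-integrable `[0, t] (EFin \o (fun=> q)).
  by apply: integrable_within; apply: continuous_subspaceT => s; exact: cvg_cst.
have iqh : leb.-integrable `[0, t] (EFin \o (fun s => q * h n s)).
  apply: integrable_within; apply: continuous_subspaceT => s.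
  by apply: cvgM; [exact: cvg_cst|exact: ch].
apply: (@le_trans _ _ (\int[leb]_(s in `[0, t]) (q + q * h n s))).
  apply: le_trans (le_normr_Rintegral _ _) _ => //; first exact: integrable_within (cr n).
  apply: le_Rintegral => //.
    have /integrable_abse := integrable_within (cr n).
    exact.
  have := integrableD _ iq iqh; exact.
have Iq : \int[leb]_(s in `[0, t]) q = q * t.
  have mt : fine (leb `[0, t]%classic) = t.
    rewrite lebesgue_measure_itv/= lte_fin; move: t0; rewrite le_eqVlt.
    by move=> /predU1P[<-|->]; rewrite ?ltxx// -EFinB subr0.
  by rewrite Rintegral_cst//; congr (_ * _).
rewrite (RintegralD _ iq iqh)// (RintegralZl _ _ ih)// Iq.
rewrite -mulrDr (@le_trans _ _ (q * B))//.
  rewrite ler_pM2l// /B; move: hH; lra.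
by rewrite /q divfK// gt_eqF.
Unshelve. all: by end_near. Qed.

End PathwiseLimit.

(** * Lebesgue-Stieltjes integrals *)

Section LebesgueStieltjes.
Context {R : realType} (F : cumulative R R).
Notation leb := (@lebesgue_measure R).
Notation lsF := (lebesgue_stieltjes_measure F).
Implicit Types f : R -> R.

Lemma lebesgue_stieltjes_itvoc a b : a <= b -> lsF `]a, b] = (F b - F a)%:E.
Proof.
move=> ab; rewrite /lebesgue_stieltjes_measure/= /measure_extension.
rewrite measurable_mu_extE/=; last exact: is_ocitv.
by rewrite wlength_itv_bnd.
Qed.

Lemma lebesgue_stieltjes_bounded_fin (a b c : R) (i : bool) :
  c < a -> a <= b -> (lsF [set` Interval (BSide i a) (BRight b)] < +oo)%E.
Proof.
move=> ca ab; apply: (@le_lt_trans _ _ (lsF `]c, b])).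
  apply: le_measure; rewrite ?inE; [exact: measurable_itv|exact: measurable_itv|].
  by apply: subset_itvr; case: i; rewrite bnd_simp// ltW.
by rewrite lebesgue_stieltjes_itvoc ?ltry// (le_trans (ltW ca)).
Qed.

Lemma lebesgue_stieltjes_integrable f t : 0 <= t -> {within `[0, t], continuous f} ->
  lsF.-integrable `[0, t] (EFin \o f).
Proof.
move=> t0 cf; apply: measurable_bounded_integrable.
- exact: measurable_itv.
- exact: (@lebesgue_stieltjes_bounded_fin 0 t (-1) true) (ltrN10 R) t0.
- by apply: subspace_continuous_measurable_fun => //; exact: measurable_itv.
- have cft : compact (f @` `[0, t])
    by apply: continuous_compact => //; exact: segment_compact.
  have [M [Mr hM]] := @compact_bounded _ R^o _ cft.
  by exists M; split => // y My x tx; apply: (hM y My); exists x.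
Qed.

(** The condition [F 0 = F (- 1)], met by a path extended by a constant, excludes an atom at 0: the
    point lies in []-1, 0]], which has mass 0. *)
Lemma Rintegral_lebesgue_stieltjes_cc f t : F 0 = F (- 1) -> 0 <= t ->
  {within `[0, t], continuous f} ->
  \int[lsF]_(s in `[0, t]) f s = \int[lsF]_(s in `]0, t]) f s.
Proof.
move=> F0 t0 cf.
have E : `[0, t]%classic = [set 0] `|` `]0, t].
  by rewrite -[X in X `|` _]set_itv1 -itv_bndbnd_setU// bnd_simp.
have m1 : measurable ([set 0] : set (measurableTypeR R)) by exact: measurable_set1.
have m2 : measurable (`]0, t]%classic : set (measurableTypeR R)) by exact: measurable_itv.
have fi := lebesgue_stieltjes_integrable t0 cf.
rewrite E in fi *; rewrite Rintegral_setU//; last first.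
  by apply/disj_setPS => x [/= ->]; rewrite in_itv/= ltxx.
rewrite [X in X + _](_ : _ = 0) ?add0r// /Rintegral null_set_integral//.
  apply: measurable_funS (measurable_int _ fi) => //; exact: measurableU.
apply/eqP; rewrite -measure_le0.
have <- : lsF `](-1), 0] = 0%E by rewrite lebesgue_stieltjes_itvoc ?oppr_le0 ?ler01// F0 subrr.
apply: le_measure; rewrite ?inE//.
by move=> x /= ->; rewrite in_itv/= ltrN10 lexx.
Qed.

(** Increments of the integral are at most a bound of [f] times the increments of the continuous
    [F]. *)
Lemma Rintegral_lebesgue_stieltjes_continuous f (T : R) : F 0 = F (- 1) ->
  continuous F -> 0 <= T -> {within `[0, T], continuous f} ->
  {within `[0, T], continuous (fun t => \int[lsF]_(s in `[0, t]) f s)}.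
Proof.
move=> F0 cF T0 cf.
have cfT : compact (f @` `[0, T])
    by apply: continuous_compact => //; exact: segment_compact.
have [M [Mr hM]] := @compact_bounded _ R^o _ cfT.
pose K := `|M| + 1.
have fK x : `[0, T]%classic x -> `|f x| <= K.
  move=> Tx; apply: hM; last by exists x.
  by rewrite /K (le_lt_trans (ler_norm M))// ltrDl.
have sub q : q <= T -> `[0, q] `<=` `[0, T].
  by move=> qT; apply: subset_itvl; rewrite bnd_simp.
have cft q : q <= T -> {within `[0, q], continuous f}.
  by move=> qT; exact: continuous_subspaceW (sub _ qT) cf.
have incr t t' : 0 <= t -> t <= t' -> t' <= T ->
    `|\int[lsF]_(s in `[0, t']) f s - \int[lsF]_(s in `[0, t]) f s| <= K * (F t' - F t).
  move=> t0 tt' t'T.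
  have t'0 : 0 <= t' by exact: le_trans tt'.
  have E : `[0, t']%classic = `[0, t] `|` `]t, t'].
    by rewrite -itv_bndbnd_setU// bnd_simp.
  have m1 : measurable (`[0, t]%classic : set (measurableTypeR R)) by exact: measurable_itv.
  have m2 : measurable (`]t, t']%classic : set (measurableTypeR R)) by exact: measurable_itv.
  have m3 : measurable (`[0, t']%classic : set (measurableTypeR R)) by exact: measurable_itv.
  have fi := lebesgue_stieltjes_integrable t'0 (cft _ t'T).
  have sub2 : `]t, t'] `<=` `[0, t'] by rewrite E; right.
  have fi2 : lsF.-integrable `]t, t'] (EFin \o f).
    by apply: integrableS fi => //; exact: measurable_itv.
  rewrite E in fi *; rewrite Rintegral_setU//; last first.
    apply/disj_setPS => x [] /=; rewrite !in_itv/= => /andP[_ a] /andP[b _].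
    by move: (lt_le_trans b a); rewrite ltxx.
  rewrite addrAC subrr add0r; apply: le_trans (le_normr_Rintegral _ _) _ => //.
  have Kc : \int[lsF]_(s in `]t, t']) K = K * (F t' - F t).
    rewrite Rintegral_cst//; congr (_ * _).
    rewrite -[RHS]/(fine (F t' - F t)%:E); congr fine.
    exact: lebesgue_stieltjes_itvoc.
  rewrite -Kc; apply: le_Rintegral => //.
  - by have /integrable_abse := fi2.
  - have cK : {within `[0, t'], continuous (fun=> K : R)}.
      by apply: continuous_subspaceT => x; exact: cvg_cst.
    exact: (integrableS m3 m2 sub2 (lebesgue_stieltjes_integrable t'0 cK)).
  - move=> x /sub2 /= tx; apply: fK; exact: sub tx.
have K0 : 0 < K by rewrite ltr_wpDl.
apply/subspace_continuousP => t /=; rewrite in_itv/= => /andP[t0 tT].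
apply/cvgrPdist_le => e e0.
have eK : 0 < e / K by rewrite divr_gt0.
have := cF t => /cvgrPdist_le /(_ _ eK).
rewrite near_withinE; apply: filterS => s Fs; rewrite /= in_itv/= => /andP[s0 sT].
have step : K * `|F t - F s| <= e by rewrite mulrC -ler_pdivlMr.
apply: le_trans step.
have [ts|st] := leP t s.
  rewrite distrC (le_trans (incr _ _ t0 ts sT))// ler_wpM2l ?(ltW K0)//.
  by rewrite distrC ler_norm.
by rewrite (le_trans (incr _ _ s0 (ltW st) tT))// ler_wpM2l ?(ltW K0)// ler_norm.
Qed.

(** Gives measurability in [w] of an integral whose measure itself depends on [w]. *)
Lemma rssum_lebesgue_stieltjes_cvg f t : F 0 = F (- 1) -> 0 <= t ->
  {within `[0, t], continuous f} ->
  rssum f F t m @[m --> \oo] --> \int[lsF]_(s in `[0, t]) f s.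
Proof.
move=> F0 t0 cf; rewrite Rintegral_lebesgue_stieltjes_cc//.
have Ft : 0 <= F t - F 0 by rewrite subr_ge0 cumulative_is_nondecreasing.
apply/cvgrPdist_le => e e0.
have e'0 : 0 < e / (F t - F 0 + 1) by rewrite divr_gt0// ltr_wpDl.
have [N hN] := rssum_approx t0 cf e'0.
exists N => // m /= Nm.
have f1 : (fun x => f x * 1) = f by apply/funext => x; rewrite mulr1.
have ioc g : {within `[0, t], continuous g} -> lsF.-integrable `]0, t] (EFin \o g).
  move=> cg; apply: integrableS (lebesgue_stieltjes_integrable t0 cg) => //.
  by apply: subset_itvr; rewrite bnd_simp.
have i1 : lsF.-integrable `]0, t] (EFin \o (fun=> 1 : R)).
  by apply: ioc; apply: continuous_subspaceT => x; exact: cvg_cst.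
have := hN m Nm lsF (fun=> 1) F; rewrite f1 => /(_ (ioc _ cf) i1 (fun _ _ => ler01)) H.
rewrite distrC; apply: le_trans (H _) _.
  move=> x y x0 xy yt; rewrite Rintegral_cst//=.
  rewrite mul1r; rewrite -[RHS]/(fine (F y - F x)%:E); congr fine.
  exact: lebesgue_stieltjes_itvoc.
by rewrite mulrAC ler_pdivrMr ?ltr_wpDl// ler_pM2l// lerDl.
Qed.

End LebesgueStieltjes.

(** * The Ito formula *)

Section Bracket.
Context {R : realType} (T : {posnum R}).
Context d (Omega : measurableType d) (P : probability Omega R).
Context (X Q : cprocess T Omega).
Notation leb := (@lebesgue_measure R).

(** A continuous version of the bracket may fail to be monotone on a null set; this singles out the
    paths that define a Stieltjes measure. *)
Definition has_cumulative (w : Omega) : Prop :=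
  exists F : cumulative R R, forall s, F s = stopped Q s w.

Lemma has_cumulativeP w : has_cumulative w <->
  forall p q : rat, p <= q -> stopped Q (ratr p) w <= stopped Q (ratr q) w.
Proof.
split=> [[F FQ] p q pq|H].
  by rewrite -!FQ; apply: cumulative_is_nondecreasing; rewrite ler_rat.
have nd : nondecreasing (stopped Q ^~ w).
  move=> x y xy; rewrite leNgt; apply/negP => C.
  (* A third of the assumed drop: moving [x] left and [y] right to rationals costs at most [e] each,
     so a drop remains between ordered rationals. *)
  pose e := (stopped Q x w - stopped Q y w) / 3.
  have e0 : 0 < e by rewrite divr_gt0// subr_gt0.
  have [r r0 hr] := stopped_uniform Q w e0.
  have /rat_in_itvoo[p] : x - r < x by rewrite gtrBl.
  have /rat_in_itvoo[q] : y < y + r by rewrite ltrDl.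
  rewrite !in_itv/= => /andP[yq qy] /andP[xp px].
  have pq : p <= q by rewrite -(ler_rat R) (le_trans (ltW px))// (le_trans xy)// ltW.
  have : `|stopped Q x w - stopped Q (ratr p) w| <= e.
    by apply: hr; rewrite gtr0_norm ?subr_gt0//; lra.
  have : `|stopped Q (ratr q) w - stopped Q y w| <= e.
    by apply: hr; rewrite gtr0_norm ?subr_gt0//; lra.
  have := H _ _ pq; rewrite !ler_norml => h /andP[a1 a2] /andP[a3 a4].
  by move: e0 a1 a2 a3 a4; rewrite /e; lra.
have rc : right_continuous (stopped Q ^~ w).
  by apply: right_continuousW; exact: stopped_continuous.
pose F : cumulative R R := HB.pack (stopped Q ^~ w) (isCumulative.Build _ _ _ _ nd rc).
by exists F.
Qed.

Lemma has_cumulative_measurable : measurable (has_cumulative : set Omega).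
Proof.
rewrite (_ : has_cumulative = \bigcap_(z : rat * rat) [set w | z.1 <= z.2 ->
    stopped Q (ratr z.1) w <= stopped Q (ratr z.2) w]); last first.
  apply/seteqP; split=> w.
    by move=> /has_cumulativeP H [p q] _ /=; exact: H.
  by move=> H; apply/has_cumulativeP => p q; exact: (H (p, q) I).
apply: countable_bigcapT_measurable; first exact: countableP.
move=> [p q] /=; have [pq|pq] := boolP (p <= q); last first.
  by rewrite [X in measurable X](_ : _ = setT)//; apply/seteqP; split => w.
have : measurable_fun setT (fun w => stopped Q (ratr p) w - stopped Q (ratr q) w).
  by apply: measurable_funB; exact: stopped_measurable.
move=> /(_ measurableT `]-oo, 0]%classic (measurable_itv _)); rewrite setTI.
congr measurable; apply/seteqP; split => w /=; rewrite in_itv/= subr_le0; first by [].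
exact.
Qed.

Lemma increment_continuous w (e : R) :
  continuous (fun s => (stopped X (s + e) w - stopped X s w) ^+ 2).
Proof.
have c : continuous (fun s => stopped X (s + e) w - stopped X s w).
  move=> s; apply: cvgB; last exact: stopped_continuous.
  apply: (@continuous_comp _ _ _ (fun s => s + e) (stopped X ^~ w)).
    by apply: cvgD; [exact: cvg_id|exact: cvg_cst].
  exact: stopped_continuous.
by move=> s; apply: cvgM; exact: c.
Qed.

(** The approximations of the bracket are nondecreasing in time, and along one sequence they
    converge almost surely at all clamped rational times, which passes monotonicity to [Q]. *)
Lemma has_cumulative_ae : is_quadratic_variation P X Q ->
  {ae P, forall w, has_cumulative w}.
Proof.
move=> qv.
pose r_ (j : nat) : rat := odflt 0 (unpickle j).
pose tau (q : rat) : R := Num.min T%:num (Num.max 0 (ratr q)).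
have tauT q : time_itv T (tau q) by exact: clamp_time.
have [|e_ [e0 _ _ ae]] := in_probability_ae_subsequence (A := setT)
    (fun j => qv (tau (r_ j)) (tauT _)).
  by move=> r r0; exists (r / 2); split => //;
    [rewrite divr_gt0|rewrite ltr_pdivrMr// ltr_pMr// ltr1n].
apply: filterS ae => w cw; apply/has_cumulativeP => p q pq.
have c s := cw (pickle (s : rat)).
have := c p; have := c q; rewrite /r_ !pickleK/= => cq cp.
apply: (ler_cvg_to cp cq); apply: nearW => n.
rewrite ler_pM2l ?invr_gt0//.
have : tau p <= tau q.
  by rewrite /tau le_min ge_min lexx/= ge_min ge_max !le_max lexx/= ler_rat pq !orbT.
have ci b : leb.-integrable `[0, b]
    (EFin \o (fun s => (stopped X (s + e_ n) w - stopped X s w) ^+ 2)).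
  by apply: integrable_within; apply: continuous_subspaceT; exact: increment_continuous.
have tp0 : 0 <= tau p by have := tauT p; rewrite time_itvE => /andP[].
move=> tt; rewrite -subr_ge0 (@Rintegral_itvB _ _ (BLeft 0) (BRight (tau q)) (tau p))//.
by apply: Rintegral_ge0 => s _; exact: sqr_ge0.
Qed.

End Bracket.

(** * The candidate for the forward integral *)

Section ItoProcess.
Context {R : realType} (T : {posnum R}).
Context d (Omega : measurableType d) (P : probability Omega R).
Context (X Q : cprocess T Omega) (u : R -> bpath T -> R) (C12u : bpath_C12 u).
Notation leb := (@lebesgue_measure R).
Local Notation win s w := (bpath_of_cpath (window X s w)).

Let v s w := u s (win s w).
Let b s w := Dt T u s (win s w) + DH u s (win s w).
Let Y s w := DV u s (win s w).
Let Z s w := DVV u s (win s w).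

Let cv w : {within `[0, T%:num], continuous (v ^~ w)}.
Proof. by have [cu _ _ _] := C12u; exact: functional_win_continuous cu. Qed.

Let cb w : {within `[0, T%:num], continuous (b ^~ w)}.
Proof.
have [_ [_ cdt] _ _] := C12u.
have /subspace_continuousP c1 := functional_win_continuous (X := X) (w := w) cdt.
have /subspace_continuousP c2 := DH_win_continuous (X := X) (w := w) C12u.
by apply/subspace_continuousP => s Ts; apply: cvgD; [exact: c1|exact: c2].
Qed.

Let cY w : {within `[0, T%:num], continuous (Y ^~ w)}.
Proof. by have [_ _ _ [_ c _]] := C12u; exact: functional_win_continuous c. Qed.

Let cZ w : {within `[0, T%:num], continuous (Z ^~ w)}.
Proof. by have [_ _ _ [_ _ c]] := C12u; exact: functional_win_continuous c. Qed.

Let subT (f : R -> R) t : t <= T%:num -> {within `[0, T%:num], continuous f} ->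
  {within `[0, t], continuous f}.
Proof. by move=> tT; apply: continuous_subspaceW; apply: subset_itvl; rewrite bnd_simp. Qed.

Let mb s : time_itv T s -> measurable_fun setT (b s).
Proof.
move=> Ts; have [_ [_ cdt] _ _] := C12u; apply: measurable_funD.
  exact: functional_win_measurable.
exact: DH_win_measurable.
Qed.

Let mZ s : time_itv T s -> measurable_fun setT (Z s).
Proof. by have [_ _ _ [_ _ c]] := C12u; exact: functional_win_measurable. Qed.

Let mY s : time_itv T s -> measurable_fun setT (Y s).
Proof. by have [_ _ _ [_ c _]] := C12u; exact: functional_win_measurable. Qed.

Let drift_part t w := v t w - v 0 w - \int[leb]_(s in `[0, t]) b s w.

(* The Ito formula solved for the forward integral; 0 where the path of Q is
   not monotone. *)
Definition ito_val (t : R) (w : Omega) : R :=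
  match pselect (has_cumulative Q w) with
  | left h => drift_part t w -
      2^-1 * \int[lebesgue_stieltjes_measure (sval (cid h))]_(s in `[0, t]) Z s w
  | right _ => 0
  end.

Let partition_time t m k : time_itv T t -> (k <= m.+1)%N ->
  time_itv T (t * (k%:R / m.+1%:R)).
Proof.
rewrite !time_itvE => /andP[t0 tT] km; rewrite mulr_ge0//= ?divr_ge0//.
by rewrite (le_trans _ tT)// ler_piMr// ler_pdivrMr// mul1r ler_nat.
Qed.

(** The approximating sums use the path of [Q] itself instead of the chosen cumulative function, so
    the choice made in [ito_val] does not affect measurability. *)
Lemma ito_val_measurable t : time_itv T t -> measurable_fun setT (ito_val t).
Proof.
move=> Tt; have := Tt; rewrite time_itvE => /andP[t0 tT].
apply: (@measurable_fun_cvg _ _ _ setT (fun m w => \1_(has_cumulative Q : set Omega) w *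
    (drift_part t w - 2^-1 * rssum (Z ^~ w) (stopped Q ^~ w) t m))).
  move=> m; apply: measurable_funM.
    by apply: measurable_indic; exact: has_cumulative_measurable.
  apply: measurable_funB.
    apply: measurable_funB.
      have [cu _ _ _] := C12u.
      apply: measurable_funB; apply: functional_win_measurable => //.
      by rewrite time_itvE lexx ge0.
    apply: Rintegral_measurable => //.
      by move=> s /andP[s0 st]; apply: mb; rewrite time_itvE s0 (le_trans st).
    by move=> w; exact: subT tT (@cb w).
  apply: measurable_funM; first exact: measurable_cst.
  rewrite /rssum; apply: measurable_sum => k; apply: measurable_funM.
    by apply: mZ; apply: partition_time => //; rewrite ltnW.
  by apply: measurable_funB; exact: stopped_measurable.
move=> w _; rewrite /ito_val; case: pselect => [h|h].
  rewrite indicE mem_set// [X in X @ _ --> _](_ : _ = fun m =>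
      drift_part t w - 2^-1 * rssum (Z ^~ w) (stopped Q ^~ w) t m); last first.
    by apply/funext => m; rewrite mul1r.
  apply: cvgB; first exact: cvg_cst.
  apply: cvgM; first exact: cvg_cst.
  case: cid => F FQ /=.
  have -> : stopped Q ^~ w = F by apply/funext => s; rewrite FQ.
  apply: rssum_lebesgue_stieltjes_cvg => //; last exact: subT tT (@cZ w).
  by rewrite !FQ !stopped_le0.
rewrite indicE memNset// [X in X @ _ --> _](_ : _ = fun=> 0); last first.
  by apply/funext => m; rewrite mul0r.
exact: cvg_cst.
Qed.

Lemma ito_val_continuous w : {within time_itv T, continuous (ito_val ^~ w)}.
Proof.
rewrite /ito_val; case: pselect => [h|h]; last first.
  by apply: continuous_subspaceT => x; exact: cvg_cst.
apply: within_continuousB.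
  apply: within_continuousB.
    apply: within_continuousB; first exact: cv.
    by apply: continuous_subspaceT => x; exact: cvg_cst.
  apply: (@parameterized_integral_continuous R 0 T%:num (b ^~ w)) => //.
  exact: integrable_within.
apply: within_continuousM; first by apply: continuous_subspaceT => x; exact: cvg_cst.
case: cid => F FQ /=.
apply: Rintegral_lebesgue_stieltjes_continuous => //.
  by rewrite !FQ !stopped_le0.
have -> : (F : R -> R) = stopped Q ^~ w by apply/funext => s; rewrite FQ.
exact: stopped_continuous.
Qed.

Definition ito_process : cprocess T Omega :=
  CProcess ito_val_measurable ito_val_continuous.

Lemma ito_process_forward : is_quadratic_variation P X Q ->
  is_forward_integral P Y X ito_process.
Proof.
move=> qv; split.
- exact: mY.
- apply: nearW => w; exact: integrable_within.
move=> t Tt; have := Tt; rewrite time_itvE => /andP[t0 tT].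
pose km (j : nat) : nat * nat := odflt (0%N, 0%N) (unpickle j).
(* The pair codes a partition point of [0, t]; [minn] keeps the time within [0, t] for every
   code. *)
pose tau (z : nat * nat) : R := t * ((minn z.2 z.1.+1)%:R / z.1.+1%:R).
have tauT z : time_itv T (tau z) by apply: partition_time => //; exact: geq_minr.
apply: (cvg_in_probability_transfer (fun j => qv (tau (km j)) (tauT _))).
- apply: nearW => e; apply: Rintegral_measurable => //.
    move=> s /andP[s0 st]; apply: measurable_funM.
      by apply: mY; rewrite time_itvE s0 (le_trans st).
    apply: measurable_funM; last exact: measurable_cst.
    by apply: measurable_funB; exact: stopped_measurable.
  move=> w; apply: within_continuousM; first exact: subT tT (@cY w).
  apply: continuous_subspaceT => s; apply: cvgM; last exact: cvg_cst.
  apply: cvgB; last exact: stopped_continuous.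
  apply: (@continuous_comp _ _ _ (fun s => s + e) (stopped X ^~ w)).
    by apply: cvgD; [exact: cvg_id|exact: cvg_cst].
  exact: stopped_continuous.
- exact: ito_val_measurable.
apply: filterS (has_cumulative_ae qv) => w hw e_ e0 ec cG /=.
rewrite /ito_val; case: pselect => // h; case: cid => F FQ /=.
have F0 : F 0 = F (- 1) by rewrite !FQ !stopped_le0.
rewrite Rintegral_lebesgue_stieltjes_cc//; last exact: subT tT (@cZ w).
have ioc f : {within `[0, t], continuous f} ->
    (lebesgue_stieltjes_measure F).-integrable `]0, t] (EFin \o f).
  move=> cf; apply: integrableS (lebesgue_stieltjes_integrable F t0 cf) => //.
  by apply: subset_itvr; rewrite bnd_simp.
apply: (@pathwise_forward_limit R T%:num t (stopped X ^~ w) (v ^~ w) (b ^~ w)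
  (Y ^~ w) (Z ^~ w) e_ (lebesgue_stieltjes_measure F) F) => //.
- exact: stopped_continuous.
- by move=> s; rewrite [RHS]stopped_id//; exact: clamp_time.
- exact: path_expansion.
- by apply: ioc; exact: subT tT (@cZ w).
- by apply: ioc; apply: continuous_subspaceT => x; exact: cvg_cst.
- move=> x y x0 xy yt; rewrite -[RHS]/(fine (F y - F x)%:E); congr fine.
  exact: lebesgue_stieltjes_itvoc.
- move=> m k km_; have := cG (pickle (m, k)); rewrite /km pickleK /tau/= (minn_idPl km_).
  rewrite FQ stopped_id//; exact: partition_time.
Qed.

End ItoProcess.

(** The functional derivatives of [U] are those of the extension by definition, whereas [Dt] is
    computed from [U]. The two quotients agree on [0, T], the only times the filter sees. *)
Lemma Dt_extends {R : realType} {T : {posnum R}} (u : R -> bpath T -> R)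
    (U : R -> cpath T -> R) t (eta : cpath T) :
  extends u U -> time_itv T t -> Dt T U t eta = Dt T u t (bpath_of_cpath eta).
Proof.
move=> uU Tt; rewrite /Dt; congr lim.
have E : {in time_itv T, quotient_t U t eta =1 quotient_t u t (bpath_of_cpath eta)}.
  by move=> s /[!inE] Ts; rewrite /quotient_t !uU.
have E' : {in time_itv T, quotient_t u t (bpath_of_cpath eta) =1 quotient_t U t eta}.
  by move=> s /E ->.
apply/seteqP; split; first exact: (fmap_within_eq (dnbhs_filter t) E').
exact: (fmap_within_eq (dnbhs_filter t) E).
Qed.

Theorem theorem2p29 (R : realType) (T : {posnum R})
    (d : measure_display) (Omega : measurableType d) (P : probability Omega R)
    (U : R -> cpath T -> R) (X Q : cprocess T Omega) :
  cpath_C12 U ->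
  is_quadratic_variation P X Q ->
  exists I : cprocess T Omega,
    is_forward_integral P (fun s w => cDV U s (window X s w)) X I /\
    {ae P, forall w,
      exists F : cumulative R R,
        (forall s, F s = stopped Q s w) /\
        forall t, time_itv T t ->
          U t (window X t w) =
            U 0 (window X 0 w)
            + \int[@lebesgue_measure R]_(s in `[0, t])
                (Dt T U s (window X s w) + cDH U s (window X s w))
            + I t w
            + 2^-1 * \int[lebesgue_stieltjes_measure F]_(s in `[0, t])
                cDVV U s (window X s w)}.
Proof.
move=> C12U qv.
have [C12u uU] : bpath_C12 (extension U) /\ extends (extension U) U.
  have [u hu] := C12U.
  by have [] := xgetPex (fun _ _ => 0) (ex_intro [set u | bpath_C12 u /\ extends u U] u hu).
exists (ito_process X Q C12u); split; first exact: ito_process_forward.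
apply: filterS (has_cumulative_ae qv) => w hw.
exists (sval (cid hw)); split; first by case: (cid hw).
move=> t Tt; have := Tt; rewrite time_itvE => /andP[t0 tT].
(* Proof irrelevance identifies the cumulative function chosen inside [ito_val] with the witness
   given here. *)
rewrite /= /ito_val; case: pselect => // h; rewrite (Prop_irrelevance h hw).
have T0 : time_itv T 0 by rewrite time_itvE lexx ge0.
have -> : \int[@lebesgue_measure R]_(s in `[0, t])
    (Dt T U s (window X s w) + cDH U s (window X s w)) =
  \int[@lebesgue_measure R]_(s in `[0, t])
    (Dt T (extension U) s (bpath_of_cpath (window X s w)) +
     DH (extension U) s (bpath_of_cpath (window X s w))).
  apply: eq_Rintegral => s; rewrite inE/= in_itv/= => /andP[s0 st].
  by rewrite (Dt_extends _ uU)// time_itvE s0 (le_trans st).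
have solve (y x i j : R) : y = x + i + (y - x - i - j) + j by ring.
by rewrite -!uU//; exact: solve.
Qed.
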